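(* Let $G$ be a finite connected general graph (loops and parallel edges allowed), and let $f\colon V(G)\to \mathbb{Z}^+$ be a function. Then \[ o(G-S)\le f(S)\qquad\text{for all vertex subsets } S\subseteq V(G) \] holds if and only if, for every $2$-end-coloring of $G$, the graph $G$ contains a colored $J_f^*$-factor.
   Context: For $S\subseteq V(G)$, $o(G-S)$ denotes the number of connected components of odd order of $G-S$, and $f(S)=\sum_{v\in S}f(v)$. A $2$-end-coloring of $G$ assigns to every end of every edge one of two colors, red or green, such that the two ends of each loop receive the same color. For an edge $e$ and a vertex $v$ define $e(v)=2$ if $e$ is a red loop at $v$; $e(v)=-2$ if $e$ is a green loop at $v$; $e(v)=1$ if $e$ is not a loop and $v$ is a red end of $e$; $e(v)=-1$ if $e$ is not a loop and $v$ is a green end of $e$; and $e(v)=0$ if $v$ is not incident with $e$. For a spanning subgraph $F$ of $G$ (with the inherited coloring), the colored degree of $v$ is $\Phi_F(v)=\sum_{e\in E(F)}e(v)$. For each vertex $v$, $J_f^*(v)$ is the set consisting of all odd integers (positive or negative) that are at most $f(v)$, together with $f(v)$ itself; i.e. $J_f^*(v)=\{\ldots,-3,-1,1,3,\ldots,f(v)\}$ if $f(v)$ is odd and $J_f^*(v)=\{\ldots,-3,-1,1,3,\ldots,f(v)-1,f(v)\}$ if $f(v)$ is even. A colored $J_f^*$-factor is a spanning subgraph $F$ of $G$ with $\Phi_F(v)\in J_f^*(v)$ for every vertex $v$. *)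

(* Defs.v *)
From HB Require Import structures.
From mathcomp Require Import all_boot all_order all_algebra.

Set Implicit Arguments.
Unset Strict Implicit.
Unset Printing Implicit Defensive.

Import GRing.Theory Num.Theory.

(* Finite general graphs. Each edge e has two ends, (e, false) and (e, true),
   attached to the vertices endpt e false and endpt e true; the order of the
   two ends carries no meaning. *)
Record general_graph := GeneralGraph {
  vertex : finType;
  edge : finType;
  endpt : edge -> bool -> vertex
}.

Section GeneralGraphs.
Variable G : general_graph.
Implicit Types (e : edge G) (v x y : vertex G) (S : {set vertex G}).

Definition is_loop e : bool := endpt e false == endpt e true.

Definition adjacent : rel (vertex G) :=
  fun x y => [exists e, exists b, (endpt e b == x) && (endpt e (~~ b) == y)].

Definition connected_graph : Prop :=
  0 < #|vertex G| /\ forall x y, connect adjacent x y.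

Definition adjacent_del S : rel (vertex G) :=
  fun x y => [&& x \notin S, y \notin S & adjacent x y].

Definition components_del S : {set {set vertex G}} :=
  equivalence_partition (connect (adjacent_del S)) (~: S).

Definition odd_components_del S : nat :=
  #|[set C in components_del S | odd #|C| ]|.

Inductive color := Red | Green.

Definition is_two_end_coloring (c : edge G -> bool -> color) : Prop :=
  forall e, is_loop e -> c e false = c e true.

Definition color_sign (k : color) : int :=
  match k with Red => 1%R | Green => (-1)%R end.

(* The integer e(v). *)
Definition end_value (c : edge G -> bool -> color) e v : int :=
  if is_loop e then
    if endpt e false == v then (2 * color_sign (c e false))%R else 0%R
  else if endpt e false == v then color_sign (c e false)
  else if endpt e true == v then color_sign (c e true)
  else 0%R.

(* A spanning subgraph of G is given by its edge set. *)
Definition colored_degree (c : edge G -> bool -> color)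
    (F : {set edge G}) v : int :=
  (\sum_(e in F) end_value c e v)%R.

Definition Jstar (f : vertex G -> nat) v (k : int) : Prop :=
  (odd `|k|%N /\ (k <= (f v)%:Z)%R) \/ (k = (f v)%:Z)%R.

Definition colored_Jstar_factor (f : vertex G -> nat)
    (c : edge G -> bool -> color) (F : {set edge G}) : Prop :=
  forall v, Jstar f v (colored_degree c F v).

End GeneralGraphs.

(* Main.v *)
Require Import Defs.
From mathcomp Require Import all_boot all_order all_algebra.
From mathcomp Require Import zify.

Set Implicit Arguments.
Unset Strict Implicit.
Unset Printing Implicit Defensive.

(** In the incidence graph of [G] (vertices and edges of [G], joined by the
    ends), complement the chosen set of ends at the green ones. A colored
    factor becomes an uncolored subgraph whose degree at each vertex [z] either
    equals a bound [f z], or is below [f z] with a prescribed parity [p z], and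
    the Tutte-type condition is inherited with "odd component" read as "component with odd [p]-sum".

    Let [g <= f <= g + 1] be the bound lowered to the parity [p]. Choose [S]
    maximising (number of odd components of the complement) - [g S], and then
    of largest size. Hall's theorem assigns every odd component to a neighbour
    in [S] so that each [s] in [S] receives between [g s] and [f s] of them;
    maximality says that every odd component, with the parity at the attached
    vertex flipped, and the union of the even components satisfy the condition
    for [g]. For [g], whose parities match [p], induction on the size of the
    graph applies: either an edge can be deleted, or the same decomposition is
    available with [S] nonempty, or every edge is a bridge between two odd
    sides, and then the whole graph is a factor.

    Conversely, color the ends at [S] red and all others green: degrees outside
    [S] are then nonpositive, hence odd, so every odd component of the complement
    sends an edge of the factor to [S]. *)

(** * Hall's theorem with lower and upper bounds *)

(** Induction on the size of [X]. If a proper nonempty subset is tight, it is matched into its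
    neighbourhood and the rest of [X] outside that neighbourhood. Otherwise every such subset has a
    spare neighbour, so one element may be matched arbitrarily and its partner deleted. *)
Lemma hall (L R : finType) (r0 : R) (X : {set L}) (N : L -> {set R}) :
    (forall Y : {set L}, Y \subset X -> #|Y| <= #|\bigcup_(y in Y) N y|) ->
  exists2 m : L -> R, {in X &, injective m} & {in X, forall y, m y \in N y}.
Proof.
move: {2}#|X| (leqnn #|X|) => n; elim: n X N => [|n IHn] X N.
  rewrite leqn0 cards_eq0 => /eqP-> _.
  by exists (fun=> r0) => [y z|y]; rewrite inE.
move=> leXn hallX.
have [/existsP[Y /and4P[Y0 sYX nYX leNY]]|noY] :=
  boolP [exists Y : {set L}, [&& Y != set0, Y \subset X, Y != X &
           #|\bigcup_(y in Y) N y| <= #|Y|]].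
  have ltYX : #|Y| < #|X| by apply: proper_card; rewrite properEneq nYX.
  have [m1 inj1 m1N] : exists2 m : L -> R,
      {in Y &, injective m} & {in Y, forall y, m y \in N y}.
    apply: IHn => [|Z sZY]; first by lia.
    by apply: hallX; apply: subset_trans sYX.
  pose NY := \bigcup_(y in Y) N y.
  have [m2 inj2 m2N] : exists2 m : L -> R, {in X :\: Y &, injective m} &
      {in X :\: Y, forall y, m y \in N y :\: NY}.
    apply: IHn => [|Z].
      by rewrite cardsD (setIidPr sYX); rewrite -card_gt0 in Y0; lia.
    rewrite subsetD => /andP[sZX dZY].
    (* Tightness of [Y] turns the Hall inequality for the union into the one for [Z] with [NY]
       removed. *)
    have := hallX (Z :|: Y); rewrite subUset sZX sYX => /(_ isT).
    rewrite bigcup_setU -/NY.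
    have -> : \bigcup_(y in Z) N y :|: NY
              = (\bigcup_(y in Z) (N y :\: NY)) :|: NY.
      apply/setP=> r; rewrite !inE; case rNY: (r \in NY); rewrite ?orbT // !orbF.
      apply/bigcupP/bigcupP=> -[z zZ rz]; exists z => //.
        by rewrite inE rNY.
      by move: rz; rewrite inE => /andP[].
    rewrite !cardsU.
    have -> : Z :&: Y = set0 by apply/eqP; rewrite setI_eq0.
    by rewrite cards0 -/NY in leNY *; lia.
  exists (fun y => if y \in Y then m1 y else m2 y) => [y z yX zX|y yX].
    have m1NY u : u \in Y -> m1 u \in NY.
      by move=> uY; apply/bigcupP; exists u; rewrite ?m1N.
    have m2NY u : u \in X -> u \notin Y -> m2 u \notin NY.
      by move=> uX uY; have := m2N u; rewrite !inE uX uY => /(_ isT)/andP[].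
    case: ifPn => yY; case: ifPn => zY.
    - exact: inj1.
    - by move=> E; have := m2NY z zX zY; rewrite -E m1NY.
    - by move=> E; have := m2NY y yX yY; rewrite E m1NY.
    by apply: inj2; rewrite inE ?yY ?zY.
  case: ifPn => yY; first exact: m1N.
  by have := m2N y; rewrite !inE yX yY => /(_ isT)/andP[].
have strict Y : Y != set0 -> Y \subset X -> Y != X ->
    #|Y| < #|\bigcup_(y in Y) N y|.
  move=> Y0 sYX nYX; rewrite ltnNge; apply: contra noY => le.
  by apply/existsP; exists Y; rewrite Y0 sYX nYX.
have [->|[x xX]] := set_0Vmem X.
  by exists (fun=> r0) => [y z|y]; rewrite inE.
have [r rx] : exists r, r \in N x.
  have := hallX [set x]; rewrite sub1set xX big_set1 cards1 => /(_ isT).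
  by move/card_gt0P.
have [m inj mN] : exists2 m : L -> R, {in X :\ x &, injective m} &
      {in X :\ x, forall y, m y \in N y :\ r}.
  apply: IHn => [|Y]; first by have := cardsD1 x X; rewrite xX; lia.
  rewrite subsetD1 => /andP[sYX xY].
  have [->|Y0] := eqVneq Y set0; first by rewrite cards0.
  have := strict Y Y0 sYX; have -> : Y != X by apply: contraNneq xY => ->.
  move=> /(_ isT).
  have -> : \bigcup_(y in Y) (N y :\ r) = (\bigcup_(y in Y) N y) :\ r.
    apply/setP=> t; rewrite !inE; apply/bigcupP/andP.
      by case=> y yY; rewrite !inE => /andP[-> ty]; split=> //; apply/bigcupP; exists y.
    by case=> tr /bigcupP[y yY ty]; exists y; rewrite // !inE tr.
  by have := cardsD1 r (\bigcup_(y in Y) N y); lia.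
have mr y : y \in X -> y != x -> m y != r.
  by move=> yX yx; have := mN y; rewrite !inE yX yx => /(_ isT)/andP[].
exists (fun y => if y == x then r else m y) => [y z yX zX|y yX].
  case: eqVneq => [->|yx]; case: eqVneq => [->|zx] //.
  - by move=> E; have := mr z zX zx; rewrite -E eqxx.
  - by move=> E; have := mr y yX yx; rewrite E eqxx.
  by apply: inj; rewrite !inE ?yx ?zx.
case: eqVneq => [->|yx] //.
by have := mN y; rewrite !inE yX yx => /(_ isT)/andP[].
Qed.

Lemma card_sum_set (T1 T2 : finType) (Y : {set T1 + T2}) :
  #|Y| = #|inl @^-1: Y| + #|inr @^-1: Y|.
Proof.
rewrite -!sum1_card big_sumType /=.
by congr (_ + _); apply: eq_bigl => z; rewrite inE.
Qed.

(** Vertices with capacities become columns of slots in a grid, so that an assignment respecting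
    capacities is an injection into the grid. *)
Lemma card_column_interval (V : finType) (n : nat) (S : {set V}) (a f : V -> nat) :
    (forall s, f s <= n) ->
  #|[set x : V * 'I_n | (x.1 \in S) && (a x.1 <= x.2 < f x.1)]|
    = \sum_(s in S) (f s - a s).
Proof.
move=> fn; rewrite -sum1_card.
under eq_bigl do rewrite inE.
rewrite -(pair_big_dep (fun s => s \in S) (fun s (j : 'I_n) => a s <= j < f s)
  (fun _ _ => 1)) /=; apply: eq_bigr => s _.
rewrite -(big_ord_widen_cond n (fun j => a s <= j) (fun=> 1)) //.
rewrite -(big_mkord (fun j => a s <= j) (fun=> 1)).
have [le|lt] := leqP (a s) (f s).
  rewrite (big_cat_nat (leq0n _) le) /= big_nat_cond big_pred0 => [|j]; last first.
    by case: (ltnP j (a s)); rewrite ?andbF // andbT.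
  rewrite add0n big_nat_cond (eq_bigl (fun j => (a s <= j < f s) && true)); last first.
    by move=> j; rewrite andbT andbAC andbb.
  by rewrite -big_nat_cond sum_nat_const_nat muln1.
rewrite big_nat_cond big_pred0 => [|j]; last by apply/negbTE; lia.
by lia.
Qed.

(* The unused capacity of [S] is filled by dummies that may only occupy slots
   numbered [g s] or more, so that Hall's theorem also enforces the lower
   bounds. *)
Lemma hall_bounds (L V : finType) (v0 : V) (adj : L -> V -> bool) (P : {set L})
    (S : {set V}) (f g : V -> nat) :
    {in S, forall s, g s <= f s} ->
    (forall Y : {set L}, Y \subset P ->
       #|Y| <= \sum_(s in [set s in S | [exists C in Y, adj C s]]) f s) ->
    (forall X : {set V}, X \subset S ->
       \sum_(s in X) g s <= #|[set C in P | [exists s in X, adj C s]]|) ->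
  exists2 m : L -> V, {in P, forall C, (m C \in S) && adj C (m C)} &
    {in S, forall s, g s <= #|[set C in P | m C == s]| <= f s}.
Proof.
move=> gf hallP hallS.
pose n := (\max_(v : V) f v).+1.
have fn v : f v <= n by apply: leqW; apply: (leq_bigmax v).
pose N := fun Y : {set L} => [set s in S | [exists C in Y, adj C s]].
(* With this number of dummies [X] is as large as the set of all slots, so a matching leaves no slot
   empty. *)
have [k kE] : exists k, k = \sum_(s in S) f s - #|P| by eexists.
have lePS : #|P| <= \sum_(s in S) f s.
  apply: leq_trans (hallP P (subxx _)) _; rewrite -/(N P) [leqRHS](big_setID (N P)).
  have -> : S :&: N P = N P by apply/setIidPr/subsetP=> s; rewrite inE => /andP[].
  exact: leq_addr.
pose slots (a : V -> nat) (T : {set V}) :=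
  [set x : V * 'I_n | (x.1 \in T) && (a x.1 <= x.2 < f x.1)].
have card_slots a T : #|slots a T| = \sum_(s in T) (f s - a s).
  exact: card_column_interval.
pose Nb (y : L + 'I_k) : {set V * 'I_n} := match y with
  | inl C => slots (fun=> 0) (N [set C])
  | inr _ => slots g S end.
pose X : {set L + 'I_k} := [set y | if y is inl C then C \in P else true].
have NYsub Y : N Y \subset S by apply/subsetP=> s; rewrite inE => /andP[].
have splitS Y h : \sum_(s in S) h s = \sum_(s in N Y) h s + \sum_(s in S :\: N Y) h s.
  by rewrite (big_setID (N Y)) /= (setIidPr (NYsub Y)).
have [m injm mN] : exists2 m : L + 'I_k -> V * 'I_n,
    {in X &, injective m} & {in X, forall y, m y \in Nb y}.
  apply: hall => [|Y sYX]; first exact: (v0, ord0).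
  pose YL := inl @^-1: Y; pose YR := inr @^-1: Y.
  have sYL : YL \subset P.
    by apply/subsetP=> C; rewrite inE => /(subsetP sYX); rewrite inE.
  have covL : slots (fun=> 0) (N YL) \subset \bigcup_(y in Y) Nb y.
    apply/subsetP=> -[s j]; rewrite inE /= => /andP[].
    rewrite inE => /andP[sS /existsP[C /andP[]]]; rewrite inE => CY adjC jf.
    apply/bigcupP; exists (inl C) => //; rewrite !inE /= sS jf andbT.
    by apply/existsP; exists C; rewrite inE eqxx.
  rewrite card_sum_set -/YL -/YR.
  (* Without dummies this is the upper Hall condition. A single dummy already sees all slots
     numbered [g s] or more, and [hallS] for the vertices of [S] not adjacent to [YL] makes up for
     all [k] dummies. *)
  have [YR0|[i iY]] := set_0Vmem YR.
    rewrite YR0 cards0 addn0; apply: leq_trans (subset_leq_card covL).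
    rewrite card_slots; under eq_bigr do rewrite subn0.
    exact: hallP.
  have covR : slots g (S :\: N YL) \subset \bigcup_(y in Y) Nb y.
    apply/subsetP=> -[s j]; rewrite inE /= => /andP[].
    rewrite inE => /andP[_ sS] jf.
    by apply/bigcupP; exists (inr i); rewrite ?inE /= ?sS //; rewrite inE in iY.
  have disj : [disjoint slots (fun=> 0) (N YL) & slots g (S :\: N YL)].
    rewrite -setI_eq0; apply/eqP/setP=> -[s j]; rewrite in_set0 !in_setI /slots.
    rewrite !in_set /= .
    by case: (s \in S) => //=; case: [exists C in YL, adj C s]; rewrite ?andbF.
  have : #|slots (fun=> 0) (N YL) :|: slots g (S :\: N YL)|
          <= #|\bigcup_(y in Y) Nb y|.
    by apply: subset_leq_card; rewrite subUset covL covR.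
  apply: leq_trans; rewrite cardsU; move: disj; rewrite -setI_eq0 => /eqP->.
  rewrite cards0 subn0 !card_slots.
  under eq_bigr do rewrite subn0.
  rewrite sumnB => [|s]; last by rewrite inE => /andP[_ /gf].
  have leYR : #|YR| <= k by have := max_card YR; rewrite card_ord.
  have : \sum_(s in S :\: N YL) g s <= #|P :\: YL|.
    apply: leq_trans (hallS _ (subsetDl _ _)) _; apply: subset_leq_card.
    apply/subsetP=> C; rewrite !inE => /andP[-> /existsP[s /andP[]]].
    rewrite inE => /andP[sN sS] adjC; rewrite andbT.
    apply: contra sN => CY; rewrite inE sS; apply/existsP; exists C.
    by rewrite inE CY.
  have le2 : \sum_(s in S :\: N YL) g s <= \sum_(s in S :\: N YL) f s.
    by apply: leq_sum => s; rewrite inE => /andP[_ /gf].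
  rewrite cardsD (setIidPr sYL); have := subset_leq_card sYL.
  by have := splitS YL f; lia.
have cardX : #|X| = #|slots (fun=> 0) S|.
  rewrite card_sum_set card_slots; under eq_bigr do rewrite subn0.
  have -> : inl @^-1: X = P by apply/setP=> C; rewrite !inE.
  have -> : inr @^-1: X = setT by apply/setP=> C; rewrite !inE.
  by rewrite cardsT card_ord kE; lia.
have sX : m @: X \subset slots (fun=> 0) S.
  apply/subsetP=> z /imsetP[y yX ->]; have := mN y yX.
  case: y {yX} => [C|i]; rewrite !inE; first by case/andP=> /andP[-> _ ->].
  by case/andP=> -> /andP[_ ->].
have imX : m @: X = slots (fun=> 0) S.
  by apply/eqP; rewrite eqEcard sX card_in_imset // cardX leqnn.
have mP C : C \in P ->
    [&& (m (inl C)).1 \in S, adj C (m (inl C)).1 & (m (inl C)).2 < f (m (inl C)).1].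
  move=> CP; have := mN (inl C); rewrite !inE => /(_ CP).
  case/andP=> /andP[-> /existsP[D /andP[]]].
  by rewrite inE => /eqP-> ->.
exists (fun C => (m (inl C)).1) => [C CP|s sS].
  by have /and3P[-> ->] := mP C CP.
set Q := [set C in P | _].
have slotn (a b : nat) : b <= f s -> #|[set j : 'I_n | a <= j < b]| = b - a.
  move=> bf; have := @card_column_interval _ n [set tt] (fun=> a) (fun=> b).
  rewrite big_set1 => <- => [|_]; last exact: leq_trans (fn s).
  rewrite -(card_imset _ (f := fun j : 'I_n => (tt, j))); last by move=> i j [].
  apply: eq_card => -[[] j]; rewrite !inE /=.
  by rewrite (mem_imset (f := fun j : 'I_n => (tt, j))) ?inE // => i i' [].
have injQ : {in Q &, injective (fun C => (m (inl C)).2)}.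
  move=> C D; rewrite !inE => /andP[CP /eqP Cs] /andP[DP /eqP Ds] E.
  have : inl C = inl D :> L + 'I_k.
    apply: injm; rewrite ?inE //.
    by rewrite [LHS]surjective_pairing [RHS]surjective_pairing Cs Ds E.
  by case.
apply/andP; split.
  (* All slots of [s] below [g s] are filled, and no dummy may occupy them. *)
  rewrite -[leqLHS]subn0 -(slotn 0 (g s)) ?gf // -(card_in_imset injQ).
  apply/subset_leq_card/subsetP=> j; rewrite inE => /= jg.
  have : (s, j) \in m @: X.
    by rewrite imX inE /= sS; apply: leq_trans jg (gf s sS).
  case/imsetP=> -[C|i] yX E; last first.
    by have := mN _ yX; rewrite -E inE /= leqNgt jg andbF.
  apply/imsetP; exists C; last by rewrite -E.
  by rewrite inE -E eqxx andbT; move: yX; rewrite inE.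
rewrite -[leqRHS]subn0 -(slotn 0 (f s)) // -(card_in_imset injQ).
apply/subset_leq_card/subsetP=> j /imsetP[C]; rewrite !inE => /andP[CP /eqP Cs] ->.
by have /and3P[_ _] := mP C CP; rewrite Cs.
Qed.

(** * Subgraphs with prescribed parities and bounds *)

Section ParitySubgraphs.
Variables (V E : finType) (ends : E -> bool -> V).
Implicit Types (A F : {set E}) (U W S T X Z : {set V}) (P : {set {set V}}).
Implicit Types (p : V -> bool) (f g : V -> nat).

Definition parity p X : bool := \big[addb/false]_(v in X) p v.

(** For [X] inside [W] this means that [X] is a union of components of the graph formed on [W] by
    the edges of [A] with both ends in [W]. *)
Definition closed_in A W X : bool :=
  [forall e in A, forall b : bool,
    (ends e b \in X) ==> (ends e (~~ b) \in W) ==> (ends e (~~ b) \in X)].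

Definition odd_set A W p X : bool :=
  [&& X \subset W, closed_in A W X & parity p X].

Definition odd_family A W p P : bool :=
  trivIset P && [forall X in P, odd_set A W p X].

(* [odd_family] stands in for the odd components of [U :\: S]: a largest odd
   family has exactly one member for every odd component. *)
Definition odd_condition A U p f : Prop :=
  forall S P, S \subset U -> odd_family A (U :\: S) p P ->
    #|P| <= \sum_(v in S) f v.

Definition deg F v : nat := \sum_(e in F) \sum_(b : bool) (ends e b == v).

Definition subgraph_in A U F : bool :=
  (F \subset A) && [forall e in F, forall b : bool, ends e b \in U].

(** * Parity sums, closed sets and odd families *)

Lemma parity_setID p X Z : parity p X = parity p (X :&: Z) (+) parity p (X :\: Z).
Proof. by rewrite /parity (big_setID Z). Qed.

Lemma parity0 p : parity p set0 = false.
Proof. by rewrite /parity big_set0. Qed.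

Lemma parity1 p v : parity p [set v] = p v.
Proof. by rewrite /parity big_set1. Qed.

Lemma eq_parity p q X : {in X, p =1 q} -> parity p X = parity q X.
Proof. by move=> pq; apply: eq_bigr. Qed.

Lemma odd_sum f X : odd (\sum_(v in X) f v) = parity (fun v => odd (f v)) X.
Proof. by rewrite (big_morph odd oddD (erefl : odd 0 = false)). Qed.

Lemma parity_neq0 p X : parity p X -> X != set0.
Proof. by apply: contraTneq => ->; rewrite parity0. Qed.

Lemma parity_cover A W p P : odd_family A W p P -> parity p (cover P) = odd #|P|.
Proof.
case/andP=> triv /forall_inP oddP; rewrite /parity big_trivIset //.
rewrite (eq_bigr (fun=> true)) => [|X /oddP/and3P[_ _]]; last by [].
rewrite -sum1_card (big_morph odd oddD (erefl : odd 0 = false)).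
exact: eq_bigr.
Qed.

Lemma closed_inP A W X :
  reflect (forall e b, e \in A -> ends e b \in X -> ends e (~~ b) \in W ->
             ends e (~~ b) \in X) (closed_in A W X).
Proof.
apply: (iffP forall_inP) => H e.
  by move=> b eA eX eW; have /forallP/(_ b) := H e eA; rewrite eX eW.
by move=> eA; apply/forallP=> b; apply/implyP=> eX; apply/implyP; apply: H.
Qed.

Lemma odd_familyP A W p P :
  reflect ({in P &, forall X Z, X != Z -> [disjoint X & Z]} /\
           {in P, forall X, odd_set A W p X}) (odd_family A W p P).
Proof.
apply: (iffP andP) => -[].
  by move/trivIsetP=> ? /forall_inP.
by move=> ? ?; split; [apply/trivIsetP|apply/forall_inP].
Qed.

Lemma odd_family_sub A W p P P' :
  P' \subset P -> odd_family A W p P -> odd_family A W p P'.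
Proof.
move=> sP /odd_familyP[dP oP]; apply/odd_familyP; split.
  by move=> X Z /(subsetP sP) XP /(subsetP sP); apply: dP.
by move=> X /(subsetP sP)/oP.
Qed.

Lemma odd_family1 A W p X : odd_set A W p X -> odd_family A W p [set X].
Proof.
move=> oX; apply/odd_familyP; split; last by move=> Z /set1P->.
by move=> Z Z' /set1P-> /set1P->; rewrite eqxx.
Qed.

Lemma closed_in_setD A W X Z : X \subset W ->
  closed_in A W X -> closed_in A W Z -> closed_in A W (X :\: Z).
Proof.
move=> sXW /closed_inP cX /closed_inP cZ.
apply/closed_inP=> e b eA; rewrite !inE => /andP[eZ eX] eW.
rewrite (cX e b) // andbT; apply: contra eZ => eZ.
rewrite -(negbK b); apply: cZ => //; rewrite negbK.
exact: (subsetP sXW).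
Qed.

Lemma closed_in_cover A W P :
  {in P, forall X, closed_in A W X} -> closed_in A W (cover P).
Proof.
move=> cP; apply/closed_inP=> e b eA /bigcupP[X XP eX] eW.
by apply/bigcupP; exists X => //; apply: (closed_inP _ _ _ (cP X XP)).
Qed.

Lemma closed_inT A W : closed_in A W W.
Proof. exact/closed_inP. Qed.

Lemma closed_in_trans A W X Z : X \subset W ->
  closed_in A W X -> closed_in A X Z -> Z \subset X -> closed_in A W Z.
Proof.
move=> sXW /closed_inP cX /closed_inP cZ /subsetP sZX.
by apply/closed_inP=> e b eA eZ eW; apply: cZ => //; apply: cX => //; apply: sZX.
Qed.

Lemma closed_inSW A W W' X : W' \subset W -> closed_in A W X -> closed_in A W' X.
Proof.
move=> /subsetP sW /closed_inP cX; apply/closed_inP=> e b eA eX eW.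
by apply: cX => //; apply: sW.
Qed.

Lemma cover_odd_family A W p P : odd_family A W p P ->
  (cover P \subset W) && closed_in A W (cover P).
Proof.
case/odd_familyP=> _ oP; apply/andP; split.
  by apply/bigcupsP=> X /oP/and3P[].
by apply: closed_in_cover => X /oP/and3P[].
Qed.

(** The members of [P] contribute [odd #|P|] to the parity of [W], so any mismatch comes from the
    uncovered rest, which is again closed. *)
Lemma odd_family_rest A W p P : odd_family A W p P ->
  odd #|P| != parity p W -> odd_set A W p (W :\: cover P).
Proof.
move=> famP par; have /andP[sP cP] := cover_odd_family famP.
rewrite /odd_set subsetDl closed_in_setD ?closed_inT //=.
move: par; rewrite (parity_setID p W (cover P)) (setIidPr sP).
by rewrite (parity_cover famP); case: (odd _); case: (parity _ _).
Qed.

(** The tool for local changes: as [Z] is closed, deleting [T] inside it does not affect the members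
    of [P]. The cardinalities add because sets of odd parity are nonempty, so no set belongs to both
    families. *)
Lemma odd_family_glue A W p P Z T P' : odd_family A W p P ->
    Z \subset W -> closed_in A W Z -> [disjoint Z & cover P] -> T \subset Z ->
    odd_family A (Z :\: T) p P' ->
  odd_family A (W :\: T) p (P :|: P') /\ #|P :|: P'| = #|P| + #|P'|.
Proof.
move=> famP sZW cZ dZP sTZ famP'.
have /odd_familyP[dP oP] := famP; have /odd_familyP[dP' oP'] := famP'.
have sXZ X : X \in P' -> X \subset Z.
  by move=> /oP'/and3P[sX _ _]; apply: subset_trans sX (subsetDl _ _).
have dXY X Y : X \in P -> Y \in P' -> [disjoint X & Y].
  move=> XP YP'; rewrite disjoint_sym; apply: disjointW dZP; first exact: sXZ.
  exact: (bigcup_max X).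
split.
  apply/odd_familyP; split.
    move=> X Y /setUP[XP|XP'] /setUP[YP|YP'].
    - exact: dP.
    - by move=> _; apply: dXY.
    - by move=> _; rewrite disjoint_sym; apply: dXY.
    exact: dP'.
  move=> X /setUP[XP|XP'].
    have /and3P[sX cX pX] := oP X XP; rewrite /odd_set pX andbT.
    rewrite (closed_inSW _ cX) ?subsetDl // andbT subsetD sX /=.
    rewrite disjoint_sym; apply: disjointW dZP => //.
    exact: (bigcup_max X).
  have /and3P[sX cX pX] := oP' X XP'; rewrite /odd_set pX andbT.
  rewrite (subset_trans sX) ?setSD //=.
  apply: (@closed_in_trans A (W :\: T) (Z :\: T)) => //; first exact: setSD.
  apply/closed_inP=> e b eA; rewrite !inE => /andP[eT eZ] /andP[-> eW].
  exact: (closed_inP _ _ _ cZ).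
rewrite cardsU (_ : P :&: P' = set0) ?cards0 ?subn0 //.
apply/setP=> X; rewrite !inE; apply/andP=> -[XP XP'].
have /and3P[_ _ /parity_neq0/set0Pn[x xX]] := oP X XP.
by have := disjointFr (dXY X X XP XP') xX; rewrite xX.
Qed.

Lemma card_members_containing P v : trivIset P -> #|[set X in P | v \in X]| <= 1.
Proof.
move=> tP; rewrite -(cards1 (pblock P v)); apply/subset_leq_card/subsetP=> X.
by rewrite !inE => /andP[XP vX]; rewrite (def_pblock tP XP vX).
Qed.

Lemma odd_condition_parity A U p f : odd_condition A U p f ->
  forall X, odd_set A U p X = false.
Proof.
move=> cnd X; apply/negP=> oX.
have := cnd set0 [set X] (sub0set _); rewrite setD0 big_set0 cards1.
by move/(_ (odd_family1 oX)).
Qed.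

Lemma odd_condition_even A U p f : odd_condition A U p f -> parity p U = false.
Proof.
move=> /odd_condition_parity/(_ U); rewrite /odd_set subxx closed_inT //=.
Qed.

(* [|P|] and [f S] have the same parity once [P] covers all of [U :\: S], so a
   violation of the condition by one can be improved to a violation by two. *)
Lemma odd_family_improve A U p f S P : parity p U = false ->
    {in U, forall v, odd (f v) = p v} -> S \subset U ->
    odd_family A (U :\: S) p P -> \sum_(v in S) f v < #|P| ->
  exists2 P', odd_family A (U :\: S) p P' & \sum_(v in S) f v + 1 < #|P'|.
Proof.
move=> pU fp sSU famP ltP.
have [lt2|ge2] := ltnP (\sum_(v in S) f v + 1) #|P|; first by exists P.
have eqP : #|P| = (\sum_(v in S) f v).+1 by lia.
have pS : parity p (U :\: S) = odd (\sum_(v in S) f v).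
  move: pU; rewrite (parity_setID p U S) (setIidPr sSU) odd_sum.
  rewrite (@eq_parity (fun v => odd (f v)) p S) => [|v /(subsetP sSU)/fp //].
  by case: (parity p S); case: (parity _ _).
have oR : odd_set A (U :\: S) p ((U :\: S) :\: cover P).
  by apply: odd_family_rest; rewrite // pS eqP /=; case: odd.
have /andP[sP cP] := cover_odd_family famP.
have [] := @odd_family_glue A (U :\: S) p P ((U :\: S) :\: cover P) set0
             [set (U :\: S) :\: cover P] famP.
- exact: subsetDl.
- by case/and3P: oR.
- by rewrite disjoint_sym disjoints_subset setCD subsetU ?subxx ?orbT.
- exact: sub0set.
- rewrite setD0; apply: odd_family1; case/and3P: oR => _ _ oR.
  by rewrite /odd_set subxx closed_inT.
rewrite setD0 => fam' card'; exists (P :|: [set (U :\: S) :\: cover P]) => //.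
by rewrite card' cards1 eqP !addn1.
Qed.

(** * Degrees and maximising pairs *)

Lemma eq_deg F F' v :
    (forall e b, ends e b = v -> (e \in F) = (e \in F')) -> deg F v = deg F' v.
Proof.
move=> eqF; rewrite /deg [LHS]big_mkcond [RHS]big_mkcond; apply: eq_bigr => e _.
have [/existsP[b /eqP/eqF->] //|none] := boolP [exists b : bool, ends e b == v].
rewrite big1 => [|b _]; first by do 2 case: ifP.
apply/eqP; rewrite eqb0; apply: contra none => eb.
by apply/existsP; exists b.
Qed.

Lemma deg_setU1 e F v : e \notin F ->
  deg (e |: F) v = \sum_(b : bool) (ends e b == v) + deg F v.
Proof. by move=> eF; rewrite /deg big_setU1. Qed.

Lemma deg0 F v : (forall e b, e \in F -> ends e b != v) -> deg F v = 0.
Proof.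
move=> noF; rewrite /deg big1 // => e eF; rewrite big1 // => b _.
by rewrite (negbTE (noF e b eF)).
Qed.

(* The last clause replaces connectedness of the members of [P]: a member
   contains no smaller closed set of odd parity. *)
Definition max_pair A U p g S P : Prop :=
  [/\ S \subset U, odd_family A (U :\: S) p P &
    forall S' P', S' \subset U -> odd_family A (U :\: S') p P' ->
    [/\ #|P'| + \sum_(v in U :\: S') g v <= #|P| + \sum_(v in U :\: S) g v,
        #|S| < #|S'| ->
          #|P'| + \sum_(v in U :\: S') g v < #|P| + \sum_(v in U :\: S) g v &
        S' = S -> #|P'| = #|P| -> #|cover P| <= #|cover P'|]].

(** The criteria are maximised lexicographically through a single number in base [N], whose two
    lower digits are at most [#|V|]. The sum of [g] over [U :\: S] stands for minus the sum over
    [S], from which it differs by a constant, so that all weights are natural numbers. *)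
Lemma max_pair_exists A U p g : exists S P, max_pair A U p g S P.
Proof.
pose N := #|V|.+1.
pose weight (x : {set V} * {set {set V}}) :=
  ((#|x.2| + \sum_(v in U :\: x.1) g v) * N + #|x.1|) * N + (#|V| - #|cover x.2|).
pose ok (x : {set V} * {set {set V}}) := (x.1 \subset U) && odd_family A (U :\: x.1) p x.2.
have ok0 : ok (set0, set0).
  rewrite /ok /= sub0set; apply/odd_familyP.
  by split=> [X Z|X]; rewrite inE.
case: (arg_maxnP weight ok0) => -[S P] /andP[/= sS fam] wmax.
exists S, P; split=> // S' P' sS' fam'.
have := wmax (S', P'); rewrite /ok /= sS' => /(_ fam'); rewrite /weight /=.
have le1 := max_card S; have le2 := max_card S'.
have le3 := max_card (cover P); have le4 := max_card (cover P').
have lex a b s t : a < b -> s <= #|V| -> a * N + s < b * N + t.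
  move=> lt les; have : a.+1 * N <= b * N by rewrite leq_mul2r lt orbT.
  by rewrite mulSn {2}/N; lia.
move=> le.
split.
- rewrite leqNgt; apply/negP=> lt; move: le; rewrite leqNgt => /negP; apply.
  by apply: (lex); [apply: lex|apply: leq_subr].
- move=> lt; rewrite ltn_neqAle; apply/andP; split.
    apply/eqP=> ab; move: le; rewrite leqNgt => /negP; apply.
    by apply: lex; [rewrite ab ltn_add2l|apply: leq_subr].
  rewrite leqNgt; apply/negP=> lt'; move: le; rewrite leqNgt => /negP; apply.
  by apply: (lex); [apply: lex|apply: leq_subr].
move=> ES EP; move: le le3 le4; rewrite ES EP leq_add2l.
by move: #|cover P| #|cover P'| #|V|; lia.
Qed.

Lemma parity_flip p x X : parity (fun v => p v (+) (v == x)) X = parity p X (+) (x \in X).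
Proof.
rewrite /parity big_split /=; congr addb.
have [xX|xX] := boolP (x \in X).
  by rewrite (bigD1 x) //= eqxx big1 // => v /andP[_ /negbTE].
by rewrite big1 // => v vX; apply/negbTE; apply: contraNneq xX => <-.
Qed.

Lemma sum_lower1 g x X : 0 < g x ->
  \sum_(v in X) (g v - (v == x)) + (x \in X) = \sum_(v in X) g v.
Proof.
move=> gx; have [xX|xX] := boolP (x \in X).
  rewrite (bigD1 x) //= [RHS](bigD1 x) //= eqxx.
  rewrite (eq_bigr g) => [|v /andP[_ /negbTE->]]; last by rewrite subn0.
  by lia.
rewrite addn0; apply: eq_bigr => v vX.
by rewrite (_ : v == x = false) ?subn0 //; apply/negbTE; apply: contraNneq xX => <-.
Qed.

Lemma sum_setDU g U S T : T \subset U :\: S ->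
  \sum_(v in U :\: S) g v = \sum_(v in T) g v + \sum_(v in U :\: (S :|: T)) g v.
Proof. by move=> sT; rewrite (big_setID T) /= (setIidPr sT) setDDl. Qed.

(** An odd family of the rest without [T] can be added to [P] while [T] joins [S]; maximality of the
    weight then bounds its size by the sum of [g] over [T]. *)
Lemma max_pair_rest A U p g S P : max_pair A U p g S P ->
  odd_condition A ((U :\: S) :\: cover P) p g.
Proof.
case=> sSU famP maxP T P' sT famP'.
have /andP[sP cP] := cover_odd_family famP.
have [|||fam' card'] := odd_family_glue famP _ _ _ sT famP'.
- exact: subsetDl.
- by apply: closed_in_setD; rewrite ?closed_inT.
- by rewrite disjoint_sym disjoints_subset setCD subsetU ?subxx ?orbT.
have sTUS : T \subset U :\: S by apply: subset_trans sT (subsetDl _ _).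
rewrite setDDl in fam'; have [|le _ _] := maxP (S :|: T) _ _ fam'.
  by rewrite subUset sSU (subset_trans sTUS) ?subsetDl.
by move: le; rewrite card' (sum_setDU g sTUS) -addnA leq_add2l leq_add2r.
Qed.

(** Exchange: [C] is traded for [P'] while [T] joins [S]. A nonempty [T] enlarges [S], so the weight
    strictly drops, and this strictness offsets the lost member [C]. For empty [T] the pair is
    compared by its cover. *)
Lemma max_pair_replace A U p g S P C T P' : max_pair A U p g S P -> C \in P ->
    T \subset C -> odd_family A (C :\: T) p P' ->
  [/\ T != set0 -> #|P'| <= \sum_(v in T) g v &
      T = set0 -> #|P'| = 1 -> #|C| <= #|cover P'|].
Proof.
case=> sSU famP maxP CP sTC famP'.
have /andP[tP _] := famP.
have /odd_familyP[_ oP] := famP; have /and3P[sC cC _] := oP C CP.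
have fam1 : odd_family A (U :\: S) p (P :\ C).
  by apply: odd_family_sub famP; apply: subsetDl.
have [|fam' card'] := odd_family_glue fam1 sC cC _ sTC famP'.
  by rewrite coverD1 // disjoints_subset setCD subsetU ?subxx ?orbT.
have sTUS : T \subset U :\: S by apply: subset_trans sC.
rewrite setDDl in fam'.
have cardP : #|P| = #|P :\ C|.+1 by rewrite (cardsD1 C) CP.
have [|_ lt eqc] := maxP (S :|: T) _ _ fam'.
  by rewrite subUset sSU (subset_trans sTUS) ?subsetDl.
split=> [T0|T0 card1].
  move: lt; rewrite cardsU (_ : S :&: T = set0); last first.
    by apply/eqP; rewrite setI_eq0; move: sTUS; rewrite subsetD disjoint_sym => /andP[].
  rewrite cards0 subn0 -{1}(addn0 #|S|) ltn_add2l card_gt0 => /(_ T0).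
  rewrite card' (sum_setDU g sTUS) cardP addSn ltnS addnA -addnA.
  by rewrite addnA leq_add2r leq_add2l.
have := eqc; rewrite T0 setU0 card' card1 cardP addn1 => /(_ erefl erefl).
rewrite [cover (_ :|: _)]bigcup_setU -!/(cover _) coverD1 // => le.
have := leq_trans le (leq_of_leqif (leq_card_setU _ _)).
have sCP : C \subset cover P by apply: (bigcup_max C).
rewrite cardsD (setIidPr sCP); move: (subset_leq_card sCP).
by clear; move: #|C| #|cover P| #|cover P'| => a b c; lia.
Qed.

(** Prepares for joining [C] to [S] by an edge at [x]: that edge uses one unit of the bound at [x]
    and flips the parity required there. A violation of the new condition would allow an exchange
    forbidden by [max_pair_replace]. *)
Lemma max_pair_hook A U p g S P C x : {in U, forall v, odd (g v) = p v} ->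
    max_pair A U p g S P -> C \in P -> x \in C ->
  0 < g x /\
  odd_condition A C (fun v => p v (+) (v == x)) (fun v => g v - (v == x)).
Proof.
move=> gp mxP CP xC; have [sSU famP _] := mxP.
have /odd_familyP[_ oP] := famP; have /and3P[sC cC pC] := oP C CP.
have sCU : C \subset U by apply: subset_trans sC (subsetDl _ _).
have gx : 0 < g x.
  (* If [g x] were zero, [p x] would be false, and moving [x] to [S] would keep [C :\ x] odd at no
     cost. *)
  rewrite lt0n; apply/negP=> /eqP gx0.
  have px : p x = false by rewrite -gp ?gx0 //; apply: (subsetP sCU).
  have [||le _] := max_pair_replace (T := [set x]) (P' := [set C :\ x]) mxP CP.
  - by rewrite sub1set.
  - apply: odd_family1; rewrite /odd_set subxx closed_inT /=.
    move: pC; rewrite (parity_setID p C [set x]) (_ : C :&: _ = [set x]) ?parity1 ?px //.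
    by apply/setIidPr; rewrite sub1set.
  have := le; rewrite big_set1 cards1 gx0 => /(_ _).
  by rewrite -card_gt0 cards1 => /(_ isT).
split=> //; set p' := fun v => _; set g' := fun v => _.
have pC' : parity p' C = false by rewrite parity_flip pC xC.
have gp' : {in C, forall v, odd (g' v) = p' v}.
  move=> v vC; rewrite /g' /p' -gp ?(subsetP sCU) //.
  by case: eqVneq => [->|_]; rewrite ?subn0 ?addbF // oddB //.
move=> T PT sTC famPT; rewrite leqNgt; apply/negP=> ltPT.
have [T0|T0] := eqVneq T set0.
  move: ltPT famPT; rewrite {T sTC}T0 big_set0 setD0 => /card_gt0P[Y YPT].
  case/odd_familyP=> _ /(_ Y YPT)/and3P[sY cY]; rewrite parity_flip => pY.
  (* If [x] is outside [Y], then [Y] is odd for the original parity; otherwise [C :\: Y] is. Either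
     one replaces [C] and shrinks the cover. *)
  have [Z [sZ cZ pZ nZ]] : exists Z, [/\ Z \subset C, closed_in A C Z, parity p Z & Z != C].
    have [xY|xY] := boolP (x \in Y); last first.
      exists Y; rewrite (negbTE xY) addbF in pY; split=> //.
      by apply: contraNneq xY => ->.
    exists (C :\: Y); rewrite subsetDl closed_in_setD ?closed_inT //; split=> //.
      move: pC; rewrite (parity_setID p C Y) (setIidPr sY).
      by rewrite xY addbT in pY; rewrite (negbTE pY).
    by apply: contraTneq xC => <-; rewrite inE xY.
  have [||_ le] := max_pair_replace (T := set0) (P' := [set Z]) mxP CP.
  - exact: sub0set.
  - by rewrite setD0; apply: odd_family1; rewrite /odd_set sZ cZ.
  move: (le erefl); rewrite cards1 cover1 => /(_ erefl).
  by rewrite leqNgt proper_card // properEneq nZ.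
(* Parity raises the excess to two, but only one can be lost in passing back to [p] and [g]: if [x]
   is in [T], through the lowered bound; if not, through the at most one member containing [x],
   which is discarded. *)
have [P' famP' ltP'] := odd_family_improve pC' gp' sTC famPT ltPT.
pose P2 := P' :\: [set X in P' | x \in X].
have famP2 : odd_family A (C :\: T) p P2.
  apply/odd_familyP; have /odd_familyP[dP' oP'] := famP'; split.
    by move=> X Y /setDP[XP _] /setDP[YP _]; apply: dP'.
  move=> X; rewrite !inE => /andP[xX XP']; rewrite XP' /= in xX.
  have /and3P[sX cX] := oP' X XP'; rewrite parity_flip (negbTE xX) addbF => pX.
  by rewrite /odd_set sX cX.
have [le _] := max_pair_replace mxP CP sTC famP2.
have := sum_lower1 T gx; rewrite -/g'.
have cardP2 : #|P'| <= #|P2| + (x \notin T).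
  have [xT|xT] := boolP (x \in T).
    rewrite addn0; apply/subset_leq_card/subsetP=> X XP'; rewrite !inE XP' andbT /=.
    apply/negP=> xX; case/odd_familyP: famP' => _ /(_ X XP')/and3P[/subsetP sX _ _].
    by have := sX x xX; rewrite inE xT.
  have := @card_members_containing P' x; case/andP: (famP') => tP' _ /(_ tP').
  rewrite /P2 cardsD => le1.
  have : #|P' :&: [set X in P' | x \in X]| <= #|[set X in P' | x \in X]|.
    by apply/subset_leq_card/subsetIr.
  rewrite addn1; move: le1; clear.
  move: #|P'| #|P' :&: _| #|[set X in P' | x \in X]| => a b c; lia.
move: (le T0) cardP2 ltP'; clear.
move: #|P'| #|P2| (\sum_(v in T) g v) (\sum_(v in T) g' v) => a b c d.
by case: (x \in T) => /=; lia.
Qed.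

(** * Factors built from a maximising pair *)

Definition parity_factor A U p f F : Prop :=
  subgraph_in A U F /\
  {in U, forall v, odd (deg F v) = p v /\ deg F v <= f v}.

Lemma subgraph_inP A U F :
  reflect (F \subset A /\ forall e b, e \in F -> ends e b \in U) (subgraph_in A U F).
Proof.
apply: (iffP andP) => -[-> H]; split=> //.
  by move=> e b eF; have /forall_inP/(_ e eF)/forallP := H.
by apply/forall_inP=> e eF; apply/forallP=> b; apply: H.
Qed.

Definition linked A X v : bool :=
  [exists e in A, exists b : bool, (ends e b \in X) && (ends e (~~ b) == v)].

Lemma linkedP A X v :
  reflect (exists e b, [/\ e \in A, ends e b \in X & ends e (~~ b) = v])
          (linked A X v).
Proof.
apply: (iffP exists_inP) => [[e eA /existsP[b /andP[eX /eqP ev]]]|[e [b [eA eX ev]]]].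
  by exists e, b.
by exists e => //; apply/existsP; exists b; rewrite eX ev eqxx.
Qed.

(** A subfamily of [P] without links to [S :\: S'] remains odd when [S] shrinks to [S']. With [S']
    the neighbours of the subfamily, [cnd] gives the upper Hall condition; with [S'] equal to
    [S :\: X], maximality of the weight gives the lower one. *)
Lemma max_pair_assignment A U p f g S P (v0 : V) : odd_condition A U p f ->
    {in U, forall v, g v <= f v} -> max_pair A U p g S P ->
  exists2 m : {set V} -> V, {in P, forall C, (m C \in S) && linked A C (m C)} &
    {in S, forall s, g s <= #|[set C in P | m C == s]| <= f s}.
Proof.
move=> cnd gf [sSU famP maxP].
have /odd_familyP[dP oP] := famP.
have reduce (Y : {set {set V}}) S' : Y \subset P ->
    (forall C s, C \in Y -> s \in S -> s \notin S' -> ~~ linked A C s) ->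
    S' \subset S -> odd_family A (U :\: S') p Y.
  move=> sYP noL sS'; apply/odd_familyP; split.
    by move=> X Z /(subsetP sYP) XP /(subsetP sYP); apply: dP.
  move=> C CY; have /and3P[sC cC pC] := oP C (subsetP sYP C CY).
  rewrite /odd_set pC andbT; apply/andP; split.
    by apply: subset_trans sC (setDS _ _).
  apply/closed_inP=> e b eA eC; rewrite inE => /andP[eS' eU].
  apply: (closed_inP _ _ _ cC) => //; rewrite inE eU andbT.
  apply/negP=> eS; have /linkedP[] := noL C _ CY eS eS'.
  by exists e, b.
apply: hall_bounds => // [s sS|Y sYP|X sXS].
- by apply: gf; apply: (subsetP sSU).
- apply: cnd.
    by apply: subset_trans sSU; apply/subsetP=> s; rewrite inE => /andP[].
  apply: reduce => // [C s CY sS|]; last by apply/subsetP=> s; rewrite inE => /andP[].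
  rewrite inE sS /=; apply: contra => lC.
  by apply/exists_inP; exists C.
set N := [set C in P | _].
have sNP : N \subset P by apply/subsetP=> C; rewrite inE => /andP[].
have [||le _ _] := maxP (S :\: X) (P :\: N).
- by apply: subset_trans sSU; apply: subsetDl.
- apply: reduce; rewrite ?subsetDl // => C s; rewrite !inE => /andP[CN CP] sS.
  rewrite sS andbT negbK => sX; rewrite CP /= in CN; apply: contra CN => lC.
  by apply/exists_inP; exists s.
move: le; have -> : \sum_(v in U :\: (S :\: X)) g v
   = \sum_(v in X) g v + \sum_(v in U :\: S) g v.
  have -> : U :\: S = U :\: (S :\: X :|: X).
    by rewrite -{1}(setID S X) (setIidPr sXS) setUC.
  apply: sum_setDU; rewrite subsetD (subset_trans sXS) //=.
  by rewrite disjoints_subset setCD subsetU ?subxx ?orbT.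
rewrite cardsD (setIidPr sNP); move: (subset_leq_card sNP); clear.
by move: #|N| #|P| (\sum_(v in X) g v) (\sum_(v in _) g v) => a b c d; lia.
Qed.

(** The factor consists of a factor of the uncovered rest and, for each member [C], one edge from
    [C] to [m C] with a factor of [C] for the data changed at that edge. Factors with matching
    parities are supplied by the hypothesis [pure], so the lemma serves both within the induction of
    [parity_factor_exists] and after it. *)
Lemma max_pair_factor A U p f g S P : odd_condition A U p f ->
    {in U, forall v, odd (g v) = p v} -> {in U, forall v, g v <= f v} ->
    max_pair A U p g S P ->
    (forall (C : {set V}) q h, C \subset U :\: S -> {in C, forall v, odd (h v) = q v} ->
       odd_condition A C q h -> exists F, parity_factor A C q h F) ->
  exists F, [/\ subgraph_in A U F,
    {in S, forall v, g v <= deg F v <= f v} &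
    {in U :\: S, forall v, odd (deg F v) = p v /\ deg F v <= g v}].
Proof.
move=> cnd gp gf mxP pure; have [sSU famP _] := mxP.
have /odd_familyP[dP oP] := famP; have /andP[sP cP] := cover_odd_family famP.
have [v0 _|V0] := pickP (@predT V); last first.
  exists set0; split=> [|v|v]; try by have := V0 v.
  by apply/subgraph_inP; split=> [|e b]; rewrite ?sub0set // inE.
have [m mP mS] := max_pair_assignment v0 cnd gf mxP.
have [FR [/subgraph_inP[sFR inFR] degFR]] : exists F,
    parity_factor A ((U :\: S) :\: cover P) p g F.
  apply: pure; first exact: subsetDl.
    by move=> v; rewrite !inE => /and3P[_ _ /gp].
  exact: max_pair_rest mxP.
(* The value [set0] outside [P] lets the later union run over all sets [C]. *)
have hook C : exists H : {set E}, if C \in P then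
     [/\ H \subset A,
         forall e b, e \in H -> (ends e b \in C) || (ends e b == m C),
         forall e, e \in H -> exists b, ends e b \in C,
         {in C, forall v, odd (deg H v) = p v /\ deg H v <= g v} &
         forall v, v \notin C -> deg H v = (v == m C)]
     else H = set0.
  have [CP|_] := boolP (C \in P); last by exists set0.
  have /and3P[sC _ _] := oP C CP.
  have /andP[mCS /linkedP[e [b [eA exC emC]]]] := mP C CP.
  have mC : m C \notin C.
    by apply/negP=> /(subsetP sC); rewrite inE mCS.
  have [gx cndC] := max_pair_hook gp mxP CP exC.
  have gpU v : v \in C -> odd (g v) = p v.
    by move=> /(subsetP sC); rewrite inE => /andP[_ /gp].
  have [|F [/subgraph_inP[sF inF] degF]] := pure C _ _ sC _ cndC.
    move=> v vC; rewrite -gpU //.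
    by case: eqVneq => [->|_]; rewrite ?subn0 ?addbF // oddB.
  have eF : e \notin F.
    by apply/negP=> /(inF _ (~~ b)); rewrite emC (negbTE mC).
  have endsE v : \sum_(b' : bool) (ends e b' == v) = (ends e b == v) + (m C == v).
    by rewrite big_bool /= -emC; case: (b); rewrite // addnC.
  exists (e |: F); split.
  - by rewrite subUset sub1set eA.
  - move=> e' b' /setU1P[->|/inF->//].
    have [->|->] : b' = b \/ b' = ~~ b.
      by case: b' (b) => -[]; [left|right|right|left].
    by rewrite exC.
    by rewrite emC eqxx orbT.
  - by move=> e' /setU1P[->|/inF H]; [exists b|exists true; apply: H].
  - move=> v vC; rewrite deg_setU1 // endsE.
    have -> : (m C == v) = false by apply: contraNF mC => /eqP->.
    have [oF leF] := degF v vC; rewrite addn0 oddD oF oddb [v == _]eq_sym.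
    rewrite addbC -addbA addbb addbF; split=> //.
    move: leF; rewrite [v == _]eq_sym; case: eqVneq => [<-|_]; last by rewrite subn0.
    by move: gx; clear; move: (g _) (deg _ _) => a c; lia.
  move=> v vC; rewrite deg_setU1 // endsE deg0 => [|e' b' /inF e'C].
    rewrite addn0 [m C == v]eq_sym; case: eqP => // ev.
    by rewrite -ev exC in vC.
  by apply: contraNneq vC => <-.
have [H Hprop] := fin_all_exists hook.
have {hook Hprop} [HP Hn] : (forall C, C \in P ->
     [/\ H C \subset A,
         forall e b, e \in H C -> (ends e b \in C) || (ends e b == m C),
         forall e, e \in H C -> exists b, ends e b \in C,
         {in C, forall v, odd (deg (H C) v) = p v /\ deg (H C) v <= g v} &
         forall v, v \notin C -> deg (H C) v = (v == m C)])
   /\ (forall C, C \notin P -> H C = set0).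
  by split=> C CP; have := Hprop C; rewrite ?CP // (negbTE CP).
have inH C e : e \in H C -> C \in P.
  by apply: contraTT => /Hn->; rewrite inE.
have mCS C : C \in P -> m C \in S by move=> /mP/andP[].
have same C D v : C \in P -> D \in P -> v \in C -> v \in D -> C = D.
  move=> CP DP vC vD; apply: contraTeq vD => nCD.
  by rewrite (disjointFr (dP C D CP DP nCD) vC).
have CS C v : C \in P -> v \in C -> v \in U :\: S.
  by move=> /oP/and3P[/subsetP sC _ _] /sC.
have disjH C D : C != D -> [disjoint H C & H D].
  move=> nCD; rewrite -setI_eq0; apply/eqP/setP=> e; rewrite !inE.
  apply/andP=> -[eC eD]; have CP := inH _ _ eC; have DP := inH _ _ eD.
  have [_ _ /(_ e eC)[b ebC] _ _] := HP C CP.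
  have [_ /(_ e b eD)/orP[ebD|/eqP ebD] _ _ _] := HP D DP.
    by rewrite (same C D _ CP DP ebC ebD) eqxx in nCD.
  by have := CS C _ CP ebC; rewrite ebD inE mCS.
pose F := FR :|: \bigcup_C H C.
have FRS e b v : e \in FR -> ends e b = v -> (v \notin S) && (v \notin cover P).
  by move=> /inFR eFR <-; have := eFR b; rewrite !inE => /and3P[-> ->].
exists F; split.
- apply/subgraph_inP; split.
    rewrite subUset sFR; apply/bigcupsP=> C _.
    have [/HP[] //|/Hn->] := boolP (C \in P); exact: sub0set.
  move=> e b /setUP[/(inFR _ b)|/bigcupP[C _ eC]].
    by rewrite !inE => /and3P[].
  have CP := inH _ _ eC; have [_ /(_ e b eC)/orP[ebC|/eqP->] _ _ _] := HP C CP.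
    by have := CS C _ CP ebC; rewrite inE => /andP[].
  exact: (subsetP sSU _ (mCS C CP)).
(* Each member assigned to [s] contributes exactly one edge end there, and nothing else in [F] meets
   [s]. *)
- move=> s sS; have -> : deg F s = #|[set C in P | m C == s]|; last exact: mS.
  have -> : deg F s = deg (\bigcup_C H C) s.
    apply: eq_deg => e b es; rewrite inE; case eFR: (e \in FR) => //.
    by have := FRS e b s eFR es; rewrite sS.
  rewrite /deg partition_disjoint_bigcup // -sum1_card.
  under [RHS]eq_bigl do rewrite inE.
  rewrite [RHS]big_mkcondr /= [RHS]big_mkcond /=; apply: eq_bigr => C _.
  case: ifPn => CP; last by rewrite Hn // big_set0.
  have [_ _ _ _ /(_ s)] := HP C CP; rewrite /deg => -> //; last first.
    by apply/negP=> /(CS C _ CP); rewrite inE sS.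
  by rewrite eq_sym; case: eqP.
move=> v vUS; have [/bigcupP[C CP vC]|vP] := boolP (v \in cover P).
  have -> : deg F v = deg (H C) v; last by have [_ _ _ /(_ v vC)] := HP C CP.
  apply: eq_deg => e b ev; apply/setUP/idP => [[eFR|/bigcupP[D _ eD]]|eC].
  - have := FRS e b v eFR ev; rewrite (_ : v \in cover P) ?andbF //.
    by apply/bigcupP; exists C.
  - have DP := inH _ _ eD; have [_ /(_ e b eD)/orP[] + _ _ _] := HP D DP.
      by rewrite ev => vD; rewrite (same C D v).
    by rewrite ev => /eqP vm; move: vUS; rewrite vm inE mCS.
  by right; apply/bigcupP; exists C.
have -> : deg F v = deg FR v; last by apply: degFR; rewrite in_setD vP.
apply: eq_deg => e b ev; apply/setUP/idP => [[//|/bigcupP[D _ eD]]|]; last by left.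
have DP := inH _ _ eD; have [_ /(_ e b eD)/orP[] + _ _ _] := HP D DP.
  by rewrite ev => vD; case/negP: vP; apply/bigcupP; exists D.
by rewrite ev => /eqP vm; move: vUS; rewrite vm inE mCS.
Qed.

(** * Edge deletion, bridges and the existence theorems *)

(** Restoring [e] can only spoil members containing an end of [e], and each end lies in at most one
    member. *)
Lemma odd_family_restore_edge A W p e P : odd_family (A :\ e) W p P ->
  exists2 P', odd_family A W p P' & #|P| <= #|P'| + 2.
Proof.
move=> famP; have /andP[tP _] := famP; have /odd_familyP[dP oP] := famP.
pose M b := [set X in P | ends e b \in X].
exists (P :\: (M false :|: M true)); last first.
  rewrite cardsD.
  have : #|P :&: (M false :|: M true)| <= #|M false :|: M true|.
    exact: subset_leq_card (subsetIr _ _).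
  have := leq_of_leqif (leq_card_setU (M false) (M true)).
  have := card_members_containing (ends e false) tP.
  have := card_members_containing (ends e true) tP; clear.
  rewrite -/(M false) -/(M true).
  move: #|M true| #|M false| #|P| #|P :&: _| #|M false :|: M true|.
  by move=> a b c d x; lia.
apply/odd_familyP; split; first by move=> X Y /setDP[XP _] /setDP[YP _]; apply: dP.
move=> X; rewrite !inE => /andP[eX XP]; rewrite XP /= negb_or in eX.
have /and3P[sX cX pX] := oP X XP; rewrite /odd_set sX pX andbT /=.
apply/closed_inP=> d b dA dX dW; apply: (closed_inP _ _ _ cX) => //.
rewrite !inE dA andbT; apply: contraTneq dX => ->.
by case/andP: eX => ? ?; case: (b).
Qed.

(* If every edge is a bridge between two odd sides then the whole graph is the
   required factor: the far sides of the edges at [v] form an odd family for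
   [[set v]], provided they are chosen minimal, hence disjoint. *)
Lemma bridges_parity_factor A U p f : odd_condition A U p f ->
    {in A, forall e, exists X, odd_set (A :\ e) U p X} ->
  parity_factor A U p f A.
Proof.
move=> cnd bridge.
have even X : X \subset U -> closed_in A U X -> parity p X = false.
  by move=> sX cX; have := odd_condition_parity cnd X; rewrite /odd_set sX cX.
have pU := odd_condition_even cnd.
(* [X] is an odd side of [e] that avoids [v], while [e] joins [v] to [X]. *)
pose far v e X := [&& odd_set (A :\ e) U p X, v \notin X &
                   [exists b : bool, (ends e b == v) && (ends e (~~ b) \in X)]].
(* No odd set is closed under all of [A], so [e] itself must leave the odd set it provides. *)
have cut e : e \in A -> exists X b, [/\ odd_set (A :\ e) U p X,
    ends e b \in X, ends e (~~ b) \in U & ends e (~~ b) \notin X].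
  move=> eA; have [X oX] := bridge e eA; have /and3P[sX cX pX] := oX.
  have [/existsP[b /and3P[? ? ?]]|none] := boolP [exists b : bool,
      [&& ends e b \in X, ends e (~~ b) \in U & ends e (~~ b) \notin X]].
    by exists X, b.
  have := even X sX; rewrite pX; case/(_ _)/eqP/notF => //.
  apply/closed_inP=> d b dA dX dU; have [de|de] := eqVneq d e; last first.
    by apply: (closed_inP _ _ _ cX); rewrite // !inE de.
  rewrite de in dX dU *; apply: contraR none => dnX.
  by apply/existsP; exists b; rewrite dX dU.
have inU e b : e \in A -> ends e b \in U.
  move=> eA; have [X [b' [/and3P[/subsetP sX _ _] /sX eU eU' _]]] := cut e eA.
  by case: (b) (b') eU eU' => -[].
have farP v e b : e \in A -> ends e b = v -> exists X, far v e X.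
  move=> eA ev; have [X [b' [oX eX eU enX]]] := cut e eA.
  (* If [v] is on the side [X], the complement serves, since [U] has even parity. *)
  have [bb|bb] := eqVneq b' b.
    have /and3P[sX cX pX] := oX; exists (U :\: X); apply/and3P; split.
    - rewrite /odd_set subsetDl closed_in_setD ?closed_inT //=.
      by move: pU; rewrite (parity_setID p U X) (setIidPr sX) pX; case: parity.
    - by rewrite inE -ev -bb eX.
    by apply/existsP; exists b; rewrite ev eqxx -bb inE enX eU.
  have bb' : ~~ b' = b by case: (b) (b') bb => -[].
  exists X; rewrite /far oX /= -ev -bb' enX /=.
  by apply/existsP; exists (~~ b'); rewrite eqxx negbK.
split; first by apply/subgraph_inP; split=> // e b; apply: inU.
move=> v vU; pose I := [set e in A | [exists b : bool, ends e b == v]].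
have [X Xmin] : exists X : E -> {set V}, forall e, e \in I -> minset (far v e) (X e).
  apply: (fin_all_exists (P := fun e X => e \in I -> minset (far v e) X)) => e.
  have [eI|eI] := boolP (e \in I); last by exists set0.
  have : exists X, far v e X.
    by move: eI; rewrite inE => /andP[eA /existsP[b /eqP]]; apply: farP eA.
  by case/ex_minset=> X mX; exists X.
have farX e : e \in I -> far v e (X e) by move=> /Xmin/minsetP[].
have other e b : e \in I -> ends e b \in X e -> ends e (~~ b) = v.
  move=> /farX/and3P[_ vX /existsP[b' /andP[/eqP ev _]]] eX.
  have [bb|bb] := eqVneq b' b; first by rewrite -bb ev (negbTE vX) in eX.
  by rewrite -ev; case: (b) (b') bb => -[].
have IA e : e \in I -> e \in A by rewrite inE => /andP[].
have mixed e d b : e \in I -> d \in I -> e != d -> ends e b \notin X d.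
  move=> eI dI ed; have /and3P[/and3P[_ cX _] vX _] := farX d dI.
  have /and3P[_ vXe /existsP[b' /andP[/eqP ev _]]] := farX e eI.
  apply/negP=> eX; have [bb|bb] := eqVneq b' b.
    by rewrite -bb ev (negbTE vX) in eX.
  have bb' : ~~ b = b' by case: (b) (b') bb => -[].
  have := closed_inP _ _ _ cX e b; rewrite bb' ev (negbTE vX) !inE ed (IA e eI).
  by move=> /(_ isT eX vU).
(* Neither [e] nor [d] meets the intersection of [X e] and [X d], which is therefore closed under
   all of [A] and even. So [X e :\: X d] is again a far side of [e], and minimality gives
   disjointness. *)
have disjX e d : e \in I -> d \in I -> e != d -> [disjoint X e & X d].
  move=> eI dI ed; have /minsetP[_ minX] := Xmin e eI.
  suff /minX/(_ (subsetDl _ _)) <- : far v e (X e :\: X d).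
    by rewrite disjoint_sym disjoints_subset setCD subsetU ?subxx ?orbT.
  have /and3P[/and3P[sX cX pX] vX /existsP[b /andP[ev ewX]]] := farX e eI.
  have /and3P[/and3P[sXd cXd pXd] vXd _] := farX d dI.
  apply/and3P; split; last 1 first.
  - by apply/existsP; exists b; rewrite ev in_setD ewX mixed.
  - rewrite /odd_set (subset_trans (subsetDl _ _)) //=; apply/andP; split.
      apply/closed_inP=> h c hA; rewrite !inE => /andP[hXd hX] hU.
      rewrite (closed_inP _ _ _ cX) // andbT; apply: contra hXd => hXd.
      have [hd|hd] := eqVneq h d.
        rewrite hd in hX hXd; have := other d (~~ c) dI hXd.
        by rewrite negbK => hv; rewrite hv (negbTE vX) in hX.
      rewrite -(negbK c); apply: (closed_inP _ _ _ cXd) => //.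
        by move: hA; rewrite !inE hd => /andP[].
      by rewrite negbK; apply: (subsetP sX).
    move: pX; rewrite (parity_setID p (X e) (X d)) even //.
      exact: subset_trans (subsetIl _ _) sX.
    apply/closed_inP=> h c hA; rewrite !inE => /andP[hX hXd] hU.
    have he : h != e by apply: contraTneq hXd => ->; apply: mixed.
    have hd : h != d by apply: contraTneq hX => ->; apply: mixed; rewrite // eq_sym.
    rewrite (closed_inP _ _ _ cX) ?inE ?he //=.
    by rewrite (closed_inP _ _ _ cXd) ?inE ?hd.
  by rewrite inE (negbTE vX) andbF.
have degI : deg A v = #|I|.
  rewrite /deg -sum1_card; under [RHS]eq_bigl do rewrite inE.
  rewrite [RHS]big_mkcondr; apply: eq_bigr => e eA.
  case: ifPn => [eI|none]; last first.
    rewrite big1 // => b _; apply/eqP; rewrite eqb0; apply: contra none => eb.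
    by apply/existsP; exists b.
  have /farX/and3P[_ vX /existsP[b /andP[/eqP ev ewX]]] : e \in I by rewrite inE eA.
  have nv : (ends e (~~ b) == v) = false by apply: contraNF vX => /eqP <-.
  by rewrite big_bool; case: (b) ev nv => /= -> ->; rewrite eqxx.
pose P := X @: I.
have neX e : e \in I -> exists2 b, ends e b = v & ends e (~~ b) \in X e.
  by move=> /farX/and3P[_ _ /existsP[b /andP[/eqP ev eX]]]; exists b.
have cardP : #|P| = #|I|.
  apply: card_in_imset => e d eI dI eXd; apply/eqP/negPn/negP=> ed.
  have [b _ eX] := neX e eI; have := mixed e d (~~ b) eI dI ed.
  by rewrite -eXd eX.
have famP : odd_family A (U :\ v) p P.
  apply/odd_familyP; split.
    move=> _ _ /imsetP[e eI ->] /imsetP[d dI ->] nX; apply: disjX => //.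
    by apply: contraNneq nX => ->.
  move=> _ /imsetP[e eI ->]; have /and3P[/and3P[sX cX pX] vX _] := farX e eI.
  rewrite /odd_set pX subsetD1 sX vX /= andbT.
  apply/closed_inP=> d b dA dX; rewrite !inE => /andP[dv dU].
  have [de|de] := eqVneq d e.
    by rewrite de in dX dv; rewrite (other e b eI dX) eqxx in dv.
  by apply: (closed_inP _ _ _ cX); rewrite // !inE de.
rewrite degI -cardP; split; last first.
  have := cnd [set v] P; rewrite sub1set big_set1; exact.
have pv : parity p (U :\ v) = p v.
  move: pU; rewrite (parity_setID p U [set v]) (_ : U :&: _ = [set v]) ?parity1.
    by case: (p v); case: parity.
  by apply/setIidPr; rewrite sub1set.
(* With the wrong parity of [#|P|], the part of [U :\ v] outside the far sides would be odd. It is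
   closed even in [U], as every edge at [v] leads into a far side. *)
apply/eqP; rewrite -pv; apply/negPn/negP=> /(odd_family_rest famP)/and3P[sR cR].
rewrite even //; first exact: subset_trans sR (subsetDl _ _).
apply/closed_inP=> e b eA eR eU; apply: (closed_inP _ _ _ cR) => //.
rewrite !inE eU andbT; apply: contraTneq eR => ev.
have eI : e \in I by rewrite inE eA; apply/existsP; exists (~~ b); rewrite ev.
have [b' ev' eX] := neX e eI; rewrite inE negb_and negbK; apply/orP; left.
apply/bigcupP; exists (X e); first exact: imset_f.
have [bb|bb] := eqVneq b' b; last by have -> : b = ~~ b' by case: (b) (b') bb => -[].
by move: eX; rewrite bb ev; have /and3P[_ /negbTE-> _] := farX e eI.
Qed.

Lemma parity_factor_exists A U p f : odd_condition A U p f ->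
  {in U, forall v, odd (f v) = p v} -> exists F, parity_factor A U p f F.
Proof.
move: {2}(#|A| + #|U|) (leqnn (#|A| + #|U|)) => n.
elim: n A U p f => [|n IHn] A U p f.
  rewrite leqn0 addn_eq0 !cards_eq0 => /andP[_ /eqP->] _ _.
  exists set0; split=> [|v]; last by rewrite inE.
  by apply/subgraph_inP; split=> [|e b]; rewrite ?sub0set // inE.
move=> leAU cnd fp; have pU := odd_condition_even cnd.
(* By parity a violation has excess at least two, which is the most that restoring one edge can
   cost. *)
pose viol e S P := [&& S \subset U, odd_family (A :\ e) (U :\: S) p P &
                       \sum_(v in S) f v + 1 < #|P|].
have [/existsP[e /andP[eA good]]|] :=
  boolP [exists e in A, ~~ [exists S, exists P, viol e S P]].
  have cnd' : odd_condition (A :\ e) U p f.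
    move=> S P sS famP; rewrite leqNgt; apply: contra good => lt.
    have [P' famP' lt'] := odd_family_improve pU fp sS famP lt.
    by apply/existsP; exists S; apply/existsP; exists P'; apply/and3P.
  have [|F [/subgraph_inP[sF inF] degF]] := IHn (A :\ e) U p f _ cnd' fp.
    by move: leAU; rewrite (cardsD1 e A) eA.
  exists F; split=> //; apply/subgraph_inP; split=> //.
  exact: subset_trans sF (subsetDl _ _).
rewrite negb_exists => /forallP noe.
have violE e : e \in A -> exists S P, viol e S P.
  move=> eA; have := noe e; rewrite eA /= negbK => /existsP[S /existsP[P vP]].
  by exists S, P.
have [/existsP[e /existsP[S /existsP[P /and3P[eA S0 vP]]]]|none] :=
  boolP [exists e, exists S, exists P, [&& e \in A, S != set0 & viol e S P]].
  have /and3P[sSU famP ltP] := vP.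
  have [P1 famP1 leP1] := odd_family_restore_edge famP.
  have [S' [P' mxP]] := max_pair_exists A U p f.
  have [sS' famP' maxP] := mxP.
  (* For empty [S'] the condition makes [P'] empty, and the pair of [S] and [P1] has at least the
     same weight with a larger set, against the choice of [S']. *)
  have S'0 : S' != set0.
    apply/negP=> /eqP S'E; have [_ lt _] := maxP S P1 sSU famP1.
    move: lt; rewrite S'E cards0 card_gt0 => /(_ S0).
    have := cnd S' P' sS' famP'; rewrite S'E big_set0 leqn0 => /eqP->.
    rewrite setD0 add0n [\sum_(v in U) _](big_setID S) /= (setIidPr sSU).
    move: ltP leP1; clear; move: #|P| #|P1| (\sum_(v in S) f v) (\sum_(v in _) f v).
    by move=> a b c d; lia.
  (* Here both bounds are [f], so degrees on [S'] are exactly [f]; the induction applies inside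
     [U :\: S'], which is smaller than [U]. *)
  have [|C q h sC hq cndC|F [inF degS degR]] := max_pair_factor cnd fp _ mxP.
  - by [].
  - apply: IHn => //; have : #|C| < #|U|.
      apply: leq_ltn_trans (subset_leq_card sC) _; rewrite cardsD (setIidPr sS').
      move: S'0 (subset_leq_card sS'); rewrite -card_gt0; clear.
      by move: #|S'| #|U| => a b; lia.
    by move: leAU; clear; move: #|A| #|C| #|U| => a b c; lia.
  exists F; split=> // v vU; have [vS|vS] := boolP (v \in S').
    have := degS v vS; rewrite -eqn_leq => /eqP <-.
    by split; [apply: fp|].
  by apply: degR; rewrite inE vS.
exists A; apply: bridges_parity_factor => // e eA.
have [S [P vP]] := violE e eA; have /and3P[_ famP ltP] := vP.
have S0 : S = set0.
  apply/eqP; apply: contraR none => S0; apply/existsP; exists e.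
  by apply/existsP; exists S; apply/existsP; exists P; rewrite eA S0.
have /card_gt0P[X XP] : 0 < #|P| by apply: leq_ltn_trans ltP.
by exists X; case/odd_familyP: famP => _ /(_ X XP); rewrite S0 setD0.
Qed.

(** The hypothesis on positive values ensures that lowering [f] by one to reach the parity [p] is
    not truncated at zero. On [S] the degree lies between [g] and [f], which differ by at most
    one. *)
Theorem almost_parity_factor_exists A U p f : odd_condition A U p f ->
    {in U, forall v, odd (f v) != p v -> 0 < f v} ->
  exists2 F, subgraph_in A U F &
    {in U, forall v, odd (deg F v) = p v /\ deg F v <= f v \/ deg F v = f v}.
Proof.
move=> cnd fpos; pose g v := f v - (odd (f v) != p v).
have gp : {in U, forall v, odd (g v) = p v}.
  move=> v vU; have := fpos v vU; rewrite /g; case: eqVneq => [fv|ne] /=.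
    by rewrite subn0.
  by move=> /(_ isT) f0; rewrite oddB //; case: (p v) (odd _) ne => -[].
have gf v : g v <= f v by apply: leq_subr.
have [S [P mxP]] := max_pair_exists A U p g.
have [|C q h _ hq cndC|F [inF degS degR]] := max_pair_factor cnd gp _ mxP.
- by move=> v _.
- exact: parity_factor_exists.
exists F => // v vU; have [vS|vS] := boolP (v \in S); last first.
  left; have [|-> le] := degR v; first by rewrite inE vS.
  by split=> //; apply: leq_trans (gf v).
have /andP[ge le] := degS v vS.
have [->|ne] := eqVneq (deg F v) (f v); [by right|left]; split=> //.
suff -> : deg F v = g v by apply: gp.
move: ge le ne; rewrite /g; clear; move: (deg F v) (f v) (_ != _) => a b [] /=; lia.
Qed.

End ParitySubgraphs.

(** * Components and colored degrees *)

Section ComponentsAndColors.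
Variable G : general_graph.
Implicit Types (S Y K : {set vertex G}) (c : edge G -> bool -> color).
Implicit Types (F : {set edge G}).

Lemma card_fibers (T : finType) (Q : {pred T}) (h : T -> vertex G) Y :
  #|[set x in Q | h x \in Y]| = \sum_(v in Y) #|[set x in Q | h x == v]|.
Proof.
rewrite -sum1_card (partition_big h [in Y]) /=; last first.
  by move=> x; rewrite inE => /andP[].
apply: eq_bigr => v vY; rewrite -sum1_card; apply: eq_bigl => x; rewrite !inE.
by case: eqP => [->|_]; rewrite ?vY ?andbF ?andbT.
Qed.

Lemma connect_del_sym S : connect_sym (adjacent_del S).
Proof.
apply: sym_connect_sym => x y; rewrite /adjacent_del andbCA; congr [&& _, _ & _].
apply/existsP/existsP=> -[e /existsP[b /andP[e1 e2]]]; exists e; apply/existsP;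
  by exists (~~ b); rewrite negbK e1 e2.
Qed.

Lemma components_del_equiv S :
  {in ~: S & &, equivalence_rel (connect (adjacent_del S))}.
Proof.
move=> x y z _ _ _; split; first exact: connect0.
by move=> xy; rewrite (same_connect (@connect_del_sym S) xy).
Qed.

Lemma components_del_partition S : partition (components_del S) (~: S).
Proof. exact: equivalence_partitionP (@components_del_equiv S). Qed.

Lemma component_neighbor S K e b : K \in components_del S -> endpt e b \in K ->
  endpt e (~~ b) \notin S -> endpt e (~~ b) \in K.
Proof.
move=> KS eK eS; have /and3P[/eqP covS triv _] := components_del_partition S.
have eS' : endpt e b \in ~: S by rewrite -covS; apply/bigcupP; exists K.
rewrite -(def_pblock triv KS eK).
rewrite inE in eS'.
rewrite (pblock_equivalence_partition (@components_del_equiv S)) ?inE //.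
apply: connect1; rewrite /adjacent_del eS eS' /=.
by apply/existsP; exists e; apply/existsP; exists b; rewrite !eqxx.
Qed.

Lemma component_subset S K Y x : K \in components_del S -> x \in K -> x \in Y ->
    (forall e b, endpt e b \in Y -> endpt e (~~ b) \notin S ->
       endpt e (~~ b) \in Y) ->
  K \subset Y.
Proof.
move=> KS xK xY cY; have /and3P[/eqP covS triv _] := components_del_partition S.
have sKS z : z \in K -> z \in ~: S.
  by move=> zK; rewrite -covS; apply/bigcupP; exists K.
apply/subsetP=> y yK; have : connect (adjacent_del S) x y.
  rewrite -(pblock_equivalence_partition (@components_del_equiv S)) ?sKS //.
  by rewrite -/(components_del S) (def_pblock triv KS xK).
suff clY : closed (adjacent_del S) Y.
  by move=> /(closed_connect clY) <-.
apply: intro_closed; first exact: connect_del_sym.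
move=> u v /and3P[_ vS /existsP[e /existsP[b /andP[/eqP eu /eqP ev]]]] uY.
by rewrite -ev; apply: cY; rewrite ?eu ?ev.
Qed.

(** [Y] is a disjoint union of components of the complement of [S], so they cannot all be even. *)
Lemma odd_component_in S Y : Y \subset ~: S ->
    (forall e b, endpt e b \in Y -> endpt e (~~ b) \notin S ->
       endpt e (~~ b) \in Y) ->
  odd #|Y| -> exists2 K, K \in [set C in components_del S | odd #|C|] & K \subset Y.
Proof.
move=> sYS cY oddY; have /and3P[/eqP covS triv _] := components_del_partition S.
pose Q := [set K in components_del S | K \subset Y].
have [/existsP[K /andP[]]|none] := boolP [exists K in Q, odd #|K|].
  by rewrite inE => /andP[KS sK] oK; exists K; rewrite // inE KS.
have covQ : cover Q = Y.
  apply/eqP; rewrite eqEsubset; apply/andP; split.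
    by apply/bigcupsP=> K; rewrite inE => /andP[].
  apply/subsetP=> x xY; have : x \in cover (components_del S).
    by rewrite covS (subsetP sYS).
  case/bigcupP=> K KS xK; apply/bigcupP; exists K => //; rewrite inE KS /=.
  exact: component_subset KS xK xY cY.
have trivQ : trivIset Q.
  by apply: trivIsetS triv; apply/subsetP=> K; rewrite inE => /andP[].
move: oddY; rewrite -covQ -(eqP trivQ) (big_morph odd oddD (erefl : odd 0 = false)).
rewrite big1 // => K KQ; apply/negbTE; apply: contra none => oK.
by apply/existsP; exists K; rewrite KQ.
Qed.

(** Summing over ends absorbs the special case of loops: the two ends of a loop share a color and
    together give the doubled sign. *)
Lemma colored_degreeE c F v : is_two_end_coloring c ->
  (colored_degree c F v = \sum_(x : edge G * bool | (x.1 \in F) && (endpt x.1 x.2 == v))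
     color_sign (c x.1 x.2))%R.
Proof.
move=> cP; rewrite /colored_degree.
rewrite -(pair_big_dep [in F] (fun e b => endpt e b == v)
  (fun e b => color_sign (c e b))) /=.
apply: eq_bigr => e _; rewrite big_mkcond big_bool /end_value /=.
have [le|nl] := boolP (is_loop e).
  move/eqP: (le) => ->; rewrite (cP e le); case: eqP => _; last by rewrite GRing.addr0.
  by case: (c e true).
case: eqP => [ef|_]; last by rewrite GRing.addr0.
by rewrite -ef eq_sym -/(is_loop e) (negbTE nl) GRing.add0r.
Qed.

End ComponentsAndColors.

(** * Necessity of the component condition *)

Lemma colored_factor_odd_components (G : general_graph) (f : vertex G -> nat) :
    (forall v, 0 < f v) ->
    (forall c : edge G -> bool -> color, is_two_end_coloring c ->
       exists F, colored_Jstar_factor f c F) ->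
  forall S : {set vertex G}, odd_components_del S <= \sum_(v in S) f v.
Proof.
move=> f_pos factor S.
pose c (e : edge G) (b : bool) := if endpt e b \in S then Red else Green.
have cP : is_two_end_coloring c by move=> e /eqP le; rewrite /c le.
have [F FJ] := factor c cP.
pose n v := #|[set x : edge G * bool in [pred x | x.1 \in F] | endpt x.1 x.2 == v]|.
have degE v : colored_degree c F v = (if v \in S then (n v)%:Z else - (n v)%:Z)%R.
  rewrite colored_degreeE // (eq_bigr (fun=> color_sign (if v \in S then Red else Green))).
    rewrite GRing.sumr_const (_ : #|_| = n v); last first.
      by apply: eq_card => x; rewrite !inE.
    by case: ifP => _ /=; rewrite ?GRing.mulNrn ssrint.natz.
  by move=> x /andP[_ /eqP <-].
have nS v : v \in S -> n v <= f v.
  by move=> vS; have := FJ v; rewrite /Jstar degE vS => -[[_]|]; lia.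
have nK v : v \notin S -> odd (n v).
  move=> vS; have := FJ v; rewrite /Jstar degE (negbTE vS) => -[[+ _]|].
    by rewrite abszN.
  (* Outside [S] the colored degree is nonpositive and cannot equal the positive [f v]. *)
  by have := f_pos v; lia.
apply: (@leq_trans (\sum_(v in S) n v)); last exact: leq_sum.
rewrite -card_fibers; set R := [set x | _].
(* An end of a factor edge at [S] is sent to the component of the opposite end; every odd component
   is reached. *)
pose h (x : edge G * bool) := pblock (components_del S) (endpt x.1 (~~ x.2)).
apply: leq_trans (leq_imset_card h R); apply/subset_leq_card/subsetP=> K.
rewrite inE => /andP[KS oddK].
have /and3P[/eqP covS triv _] := components_del_partition S.
have [/existsP[e /existsP[b /and3P[eF eK eK']]]|none] := boolP [exists e, exists b : bool,
    [&& e \in F, endpt e b \in K & endpt e (~~ b) \notin K]].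
  apply/imsetP; exists (e, ~~ b); last by rewrite /h /= negbK (def_pblock triv KS eK).
  rewrite !inE eF /=; apply: contraR eK' => eS.
  exact: component_neighbor KS eK eS.
(* If no factor edge leaves [K], the degree sum over [K] is even, yet it has an odd number of odd
   terms. *)
have : odd (\sum_(v in K) n v).
  rewrite (big_morph odd oddD (erefl : odd 0 = false)).
  rewrite (eq_bigr (fun v => odd 1)) => [|v vK]; last first.
    apply: nK; have : v \in ~: S by rewrite -covS; apply/bigcupP; exists K.
    by rewrite inE.
  by rewrite -(big_morph odd oddD (erefl : odd 0 = false)) sum1_card.
rewrite -card_fibers -sum1_card.
rewrite (eq_bigl (fun x : edge G * bool => (x.1 \in F) && (endpt x.1 x.2 \in K))); last first.
  by move=> x; rewrite !inE.
rewrite -(pair_big_dep [in F] (fun e b => endpt e b \in K) (fun _ _ => 1)) /=.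
rewrite (big_morph odd oddD (erefl : odd 0 = false)) big1 // => e eF.
rewrite big_mkcond big_bool /=.
have same b : endpt e b \in K -> endpt e (~~ b) \in K.
  move=> eK; apply: contraR none => eK'.
  by apply/existsP; exists e; apply/existsP; exists b; rewrite eF eK.
have := same true; have := same false => /=.
case: (endpt e true \in K); case: (endpt e false \in K) => //.
  by move=> _ /(_ isT).
by move=> /(_ isT).
Qed.

(** * Reduction to the incidence graph *)

Section IncidenceGraph.
Variables (G : general_graph) (f : vertex G -> nat) (c : edge G -> bool -> color).
Local Notation iedge := (edge G * bool)%type.
Local Notation ivertex := (vertex G + edge G)%type.
Implicit Types (e : edge G) (b : bool) (v : vertex G) (x : iedge).
Implicit Types (S : {set vertex G}) (Z X : {set ivertex}) (P : {set {set ivertex}}).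

(* The edges of the incidence graph are the ends [(e, b)] of [G]. *)
Definition incidence_ends x b : ivertex :=
  if b then inr x.1 else inl (endpt x.1 x.2).

Definition green x : bool := if c x.1 x.2 is Green then true else false.

Definition greens v : nat := #|[set x in green | endpt x.1 x.2 == v]|.

Definition mixed e : bool := green (e, false) (+) green (e, true).

(** Complementing at the green ends raises the degree at [v] by [greens v] above the colored degree,
    which is to be odd. The two ends of [e] encode the same choice exactly when the degree at
    [inr e] has the parity [mixed e]. *)
Definition incidence_parity (z : ivertex) : bool :=
  match z with inl v => ~~ odd (greens v) | inr e => mixed e end.

(** A mixed edge has degree 1 in the incidence graph; any other has degree 0 or 2. *)
Definition incidence_bound (z : ivertex) : nat :=
  match z with inl v => f v + greens v | inr e => (~~ mixed e).+1 end.

Local Notation iodd_family Z := (odd_family incidence_ends setT (setT :\: Z) incidence_parity).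

Lemma incidence_closed_inr Z X e b : closed_in incidence_ends setT (setT :\: Z) X ->
  inl (endpt e b) \in X -> inr e \notin Z -> inr e \in X.
Proof.
move=> /closed_inP cX eX eZ; apply: (cX (e, b) false) => //=.
by rewrite !inE andbT.
Qed.

Lemma incidence_closed_inl Z X e b : closed_in incidence_ends setT (setT :\: Z) X ->
  inr e \in X -> inl (endpt e b) \notin Z -> inl (endpt e b) \in X.
Proof.
move=> /closed_inP cX eX eZ; apply: (cX (e, b) true) => //=.
by rewrite !inE andbT.
Qed.

Lemma incidence_closed Z X :
    (forall e b, inl (endpt e b) \in X -> inr e \notin Z -> inr e \in X) ->
    (forall e b, inr e \in X -> inl (endpt e b) \notin Z -> inl (endpt e b) \in X) ->
  closed_in incidence_ends setT (setT :\: Z) X.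
Proof.
move=> cr cl; apply/closed_inP=> -[e b] [] _ /=; rewrite !inE andbT.
  exact: cl.
exact: cr.
Qed.

(** Each vertex of [G] in [X] counts one plus its green ends, each edge its green ends. A green end
    at a vertex in [X] is counted twice and cancels, leaving the green ends at [S] of edges in
    [X]. *)
Lemma incidence_parityE S X : X \subset setT :\: inl @: S ->
    closed_in incidence_ends setT (setT :\: inl @: S) X ->
  parity incidence_parity X = odd #|inl @^-1: X|
    (+) odd #|[set x in green | (inr x.1 \in X) && (endpt x.1 x.2 \in S)]|.
Proof.
move=> sX cX.
have nS v : inl v \in X -> v \notin S.
  move=> /(subsetP sX); rewrite !inE andbT; apply: contra => vS; exact: imset_f.
have inrS e : inr e \notin (inl @: S : {set ivertex}).
  by apply/imsetP=> -[].
pose N1 := [set x in green | endpt x.1 x.2 \in inl @^-1: X].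
pose N2 := [set x in green | inr x.1 \in X].
have -> : [set x in green | (inr x.1 \in X) && (endpt x.1 x.2 \in S)] = N2 :\: N1.
  apply/setP=> -[e b]; rewrite !inE /=; case: (_ \in green) => //=.
  case eX: (inr e \in X); rewrite ?andbF ?andbT //=.
  have [eS|eS] := boolP (endpt e b \in S).
    by apply/esym; apply: contraTN eS => /nS.
  apply/esym/negbTE; rewrite negbK; apply: incidence_closed_inl cX eX _.
  by rewrite mem_imset //; exact: inl_inj.
have sN : N1 \subset N2.
  apply/subsetP=> -[e b]; rewrite !inE /= => /andP[-> eX].
  exact: incidence_closed_inr cX eX (inrS e).
rewrite cardsD (setIidPr sN) oddB ?subset_leq_card //.
rewrite /parity big_sumType /=.
rewrite [odd #|N2| (+) _]addbC addbA; congr addb.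
  rewrite card_fibers (big_morph odd oddD (erefl : odd 0 = false)).
  rewrite -sum1_card (big_morph odd oddD (erefl : odd 0 = false)).
  rewrite -big_split /=.
  by apply: eq_big => v; rewrite ?inE // addbT.
rewrite -sum1_card; under [in RHS]eq_bigl do rewrite !inE.
rewrite (eq_bigl (fun x : iedge => (inr x.1 \in X) && green x)); last first.
  by move=> x; rewrite andbC.
rewrite (eq_bigl (fun x : iedge => (inr x.1 \in X) && green (x.1, x.2))); last first.
  by move=> [].
rewrite -(pair_big_dep (fun e => inr e \in X) (fun e b => green (e, b)) (fun _ _ => 1)) /=.
rewrite (big_morph odd oddD (erefl : odd 0 = false)); apply: eq_bigr => e _.
by rewrite big_mkcond big_bool /mixed; do 2 case: (green _).
Qed.

(** By [incidence_parityE], a member with an odd number of vertices of [G] contains an odd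
    component, and any other contains an edge with a green end at [S]. Disjointness makes both
    choices injective. *)
Lemma incidence_odd_family_base S P : iodd_family (inl @: S) P ->
  #|P| <= odd_components_del S + \sum_(v in S) greens v.
Proof.
move=> famP; have /odd_familyP[dP oP] := famP; have /andP[tP _] := famP.
have inrS e : inr e \notin (inl @: S : {set ivertex}).
  by apply/imsetP=> -[].
have inlS v : (inl v \in (inl @: S : {set ivertex})) = (v \in S).
  by rewrite mem_imset //; apply: inl_inj.
pose P1 := [set X in P | odd #|inl @^-1: X|].
have sP1 : P1 \subset P by apply/subsetP=> X; rewrite inE => /andP[].
rewrite -(cardsID P1 P) (setIidPr sP1); apply: leq_add.
  have comp X : exists K, X \in P1 ->
      K \in [set C in components_del S | odd #|C|] /\ K \subset inl @^-1: X.
    have [XP1|] := boolP (X \in P1); last by exists set0.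
    move: XP1; rewrite inE => /andP[XP oddX].
    have /and3P[sX cX _] := oP X XP.
    have [| |K KS sK] := odd_component_in (S := S) _ _ oddX.
    - apply/subsetP=> v; rewrite !inE => /(subsetP sX).
      by rewrite !inE andbT inlS.
    - move=> e b; rewrite !inE => eX eS.
      have eX' := incidence_closed_inr cX eX (inrS e).
      by apply: incidence_closed_inl cX eX' _; rewrite inlS.
    by exists K.
  have [h hP] := fin_all_exists comp.
  rewrite -(card_in_imset (f := h) (D := P1)).
    by apply/subset_leq_card/subsetP=> _ /imsetP[X /hP[+ _] ->].
  move=> X Y XP1 YP1 hXY; apply/eqP/negPn/negP=> nXY.
  have [+ sX] := hP X XP1; have [_ sY] := hP Y YP1; rewrite inE => /andP[_ odd_hX].
  have /card_gt0P[v vh] : 0 < #|h X| by apply: odd_gt0.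
  have := subsetP sX v vh; rewrite inE => vX.
  rewrite hXY in vh; have := subsetP sY v vh; rewrite inE => vY.
  have := dP X Y (subsetP sP1 X XP1) (subsetP sP1 Y YP1) nXY.
  by move/disjointFr/(_ vX); rewrite vY.
rewrite -card_fibers; set R := [set x in green | _].
pose h (x : iedge) := pblock P (inr x.1).
apply: leq_trans (leq_imset_card h R); apply/subset_leq_card/subsetP=> X.
rewrite !inE => /andP[+ XP]; rewrite XP /= => evenX.
have /and3P[sX cX] := oP X XP; rewrite (incidence_parityE sX cX) (negbTE evenX) /=.
move=> /odd_gt0/card_gt0P[[e b]]; rewrite inE /= => /and3P[ge eX eS].
apply/imsetP; exists (e, b); first by rewrite inE ge.
by rewrite /h (def_pblock tP XP eX).
Qed.

(** Induction on the number of edges of [G] in [Z], returning one edge [e] to the complement. At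
    most two members contain ends of [e]. If [e] is not mixed, its bound 2 pays for dropping them;
    if it is mixed, its bound 1 pays for dropping one, or for merging two with [e] into a single odd
    set. *)
Lemma incidence_odd_condition :
    (forall S, odd_components_del S <= \sum_(v in S) f v) ->
  odd_condition incidence_ends setT setT incidence_parity incidence_bound.
Proof.
move=> cnd Z P _; move: {2}#|inr @^-1: Z| (leqnn #|inr @^-1: Z|) => n.
elim: n Z P => [|n IHn] Z P.
  rewrite leqn0 cards_eq0 => /eqP noZ.
  pose S := inl @^-1: Z; have -> : Z = inl @: S.
    apply/setP=> -[v|e].
      by rewrite mem_imset ?inE //; apply: inl_inj.
    have -> : (inr e \in Z) = false by have := in_set0 e; rewrite -noZ inE.
    by apply/esym/negbTE/imsetP=> -[].
  move=> /incidence_odd_family_base leP.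
  rewrite big_imset /=; last by move=> u v _ _ [].
  by rewrite big_split /=; apply: leq_trans leP _; rewrite leq_add2r.
move=> leZ famP; have [Z0|[e]] := set_0Vmem (inr @^-1: Z).
  by apply: IHn => //; rewrite Z0 cards0.
rewrite inE => eZ; have /odd_familyP[dP oP] := famP; have /andP[tP _] := famP.
have bound' P' : iodd_family (Z :\ inr e) P' ->
    #|P'| <= \sum_(z in Z :\ inr e) incidence_bound z.
  move=> famP'; apply: IHn => //.
  have : inr @^-1: (Z :\ inr e) \proper inr @^-1: Z.
    apply/properP; split; first by apply/subsetP=> d; rewrite !inE => /andP[].
    by exists e; rewrite !inE ?eqxx.
  by move/proper_card => lt; rewrite -ltnS; apply: leq_trans lt _.
pose M b := [set X in P | inl (endpt e b) \in X].
pose P0 := P :\: (M false :|: M true).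
have sMP : M false :|: M true \subset P.
  by apply/subsetP=> X; rewrite !inE => /orP[] /andP[].
have cardP : #|P| = #|P0| + #|M false :|: M true|.
  by rewrite cardsD (setIidPr sMP) subnK // subset_leq_card.
have sub z : z \in setT :\: Z -> z \in setT :\: (Z :\ inr e).
  by rewrite !inE !andbT negb_and orbC => ->.
have inlZ v : (inl v \notin Z :\ inr e) = (inl v \notin Z) by rewrite !inE.
have fam0 : iodd_family (Z :\ inr e) P0.
  apply/odd_familyP; split.
    by move=> X Y /setDP[XP _] /setDP[YP _]; apply: dP.
  move=> X; rewrite !inE => /andP[XM XP]; rewrite XP /= negb_or in XM.
  case/andP: XM => X0 X1.
  have /and3P[sX cX pX] := oP X XP; rewrite /odd_set pX andbT; apply/andP; split.
    by apply/subsetP=> z /(subsetP sX)/sub.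
  apply: incidence_closed => d b dX.
    rewrite !inE negb_and negbK => /orP[/eqP[de]|dZ].
      by rewrite de in dX; case: b dX => dX; [case/negP: X1|case/negP: X0].
    exact: incidence_closed_inr cX dX dZ.
  by rewrite inlZ; apply: incidence_closed_inl cX dX.
rewrite (big_setD1 (inr e)) //= cardP addnC.
have cardM b : #|M b| <= 1 := card_members_containing _ tP.
have leM := leq_of_leqif (leq_card_setU (M false) (M true)).
have [mix|] := boolP (mixed e); last first.
  move=> _; apply: leq_add; last exact: bound'.
  exact: leq_trans leM (leq_add (cardM _) (cardM _)).
have [le1|gt1] := leqP #|M false :|: M true| 1.
  by apply: leq_add le1 _; apply: bound'.
have cardMU : #|M false :|: M true| = 2.
  by apply/eqP; rewrite eqn_leq gt1 (leq_trans leM (leq_add (cardM _) (cardM _))).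
pose Y := inr e |: cover (M false :|: M true).
have /andP[sM clM] : (cover (M false :|: M true) \subset setT :\: Z) &&
    closed_in incidence_ends setT (setT :\: Z) (cover (M false :|: M true)).
  by apply: cover_odd_family (odd_family_sub sMP famP).
have eM : inr e \notin cover (M false :|: M true).
  by apply/negP=> /(subsetP sM); rewrite !inE eZ.
have endM b : inl (endpt e b) \in cover (M false :|: M true).
  have : 0 < #|M b|.
    have := cardM (~~ b); move: leM; rewrite cardMU; clear.
    by case: b => /=; move: #|M true| #|M false| => k l; lia.
  case/card_gt0P=> X XM; apply/bigcupP; exists X.
    by rewrite inE; case: (b) XM => ->; rewrite ?orbT.
  by move: XM; rewrite inE => /andP[].
have oY : odd_set incidence_ends setT (setT :\: (Z :\ inr e)) incidence_parity Y.
  apply/and3P; split.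
  - apply/subsetP=> z /setU1P[->|/(subsetP sM)/sub //].
    by rewrite !inE eqxx.
  - apply: incidence_closed => d b.
      rewrite !inE /= => dM; have [->|de] := eqVneq d e; first by rewrite eqxx.
      rewrite (inj_eq (@inr_inj _ _)) (negbTE de) /= => dZ.
      exact: incidence_closed_inr clM dM dZ.
    rewrite inlZ => /setU1P[[->] _|dM dZ]; first by rewrite inE endM orbT.
    by rewrite inE (incidence_closed_inl clM dM dZ) orbT.
  rewrite /parity big_setU1 //= -/(parity _ _).
  by rewrite (parity_cover (odd_family_sub sMP famP)) cardMU mix.
have /and3P[sY cY pY] := oY.
have [||famY cardY] := odd_family_glue (P' := [set Y]) fam0 sY cY _ (sub0set Y).
- rewrite -setI_eq0; apply/eqP/setP=> z; rewrite !inE; apply/negbTE/negP.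
  case/andP=> /orP[/eqP->|/bigcupP[X XM zX]] /bigcupP[X' /setDP[XP' XM'] zX'].
    by have /and3P[/subsetP/(_ _ zX') + _ _] := oP X' XP'; rewrite !inE eZ.
  have nX : X != X' by apply: contraNneq XM' => <-.
  have := dP X X' (subsetP sMP X XM) XP' nX.
  by move/disjointFr/(_ zX); rewrite zX'.
- by rewrite setD0; apply: odd_family1; rewrite /odd_set subxx closed_inT.
rewrite setD0 in famY; have := bound' _ famY; rewrite cardY cards1 cardMU.
by rewrite addn1 add2n add1n.
Qed.

Lemma incidence_deg_inl (F : {set iedge}) v :
  deg incidence_ends F (inl v) = #|[set x in F | endpt x.1 x.2 == v]|.
Proof.
rewrite /deg -sum1_card; under [RHS]eq_bigl do rewrite inE.
rewrite [RHS]big_mkcondr; apply: eq_bigr => x _.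
by rewrite big_bool /incidence_ends /= add0n (inj_eq (@inl_inj _ _)); case: eqP.
Qed.

Lemma incidence_deg_inr (F : {set iedge}) e :
  deg incidence_ends F (inr e) = ((e, true) \in F) + ((e, false) \in F).
Proof.
rewrite /deg.
rewrite (eq_bigr (fun x : iedge => (x.1 == e) : nat)) => [|x _]; last first.
  by rewrite big_bool /incidence_ends /= addn0 (inj_eq (@inr_inj _ _)).
rewrite big_mkcond (eq_bigr (fun x : iedge => ((x.1 == e) && ((x.1, x.2) \in F)) : nat)).
  rewrite -(pair_big xpredT xpredT (fun d b => ((d == e) && ((d, b) \in F)) : nat)) /=.
  rewrite (bigD1 e) //= big_bool eqxx /= [X in _ + X]big1 ?addn0 // => d /negbTE nde.
  by rewrite big1 // => b _; rewrite nde.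
by move=> [d b] _ /=; case: ifP; rewrite ?andbT ?andbF.
Qed.

Lemma colored_factor_of_incidence (F' : {set iedge}) : is_two_end_coloring c ->
    (forall z, odd (deg incidence_ends F' z) = incidence_parity z /\
         deg incidence_ends F' z <= incidence_bound z
       \/ deg incidence_ends F' z = incidence_bound z) ->
  colored_Jstar_factor f c [set e | ((e, false) \in F') (+) green (e, false)].
Proof.
move=> cP degF'; set F := [set e | _].
(* The parity at [inr e] makes the choice read off at either end the same. *)
have memF e b : (e \in F) = ((e, b) \in F') (+) green (e, b).
  rewrite inE; case: b => //.
  have : odd (deg incidence_ends F' (inr e)) = mixed e.
    by have [[]|] := degF' (inr e) => // -> /=; case: (mixed e).
  rewrite incidence_deg_inr oddD !oddb /mixed.
  by do 2 case: (_ \in F'); do 2 case: (green _).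
move=> v; have degE : (colored_degree c F v
    = (deg incidence_ends F' (inl v))%:Z - (greens v)%:Z)%R.
  rewrite colored_degreeE // incidence_deg_inl /greens -!sum1_card.
  rewrite !(big_morph Posz PoszD (erefl : Posz 0 = 0%R)) -GRing.sumrN.
  rewrite [LHS]big_mkcond [X in (X + _)%R]big_mkcond [X in (_ + X)%R]big_mkcond /=.
  rewrite -big_split /=.
  apply: eq_bigr => -[e b] _; rewrite /= (memF e b) !inE /=.
  rewrite (_ : ((e, b) \in green) = green (e, b)) // /green /=.
  by case: (c e b); case: (_ \in F'); case: (_ == v).
rewrite /Jstar degE; case: (degF' (inl v)) => [[odd_d le_d]|->] /=.
  left; rewrite /= in odd_d le_d; move: (deg _ _ _) (greens v) odd_d le_d => d k odd_d le_d.
  by split; lia.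
by right; rewrite PoszD GRing.addrK.
Qed.

End IncidenceGraph.

Theorem theorem3p1 (G : general_graph) (f : vertex G -> nat)
    (G_connected : connected_graph G) (f_pos : forall v : vertex G, 0 < f v) :
  (forall S : {set vertex G}, odd_components_del S <= \sum_(v in S) f v)
  <->
  (forall c : edge G -> bool -> color, is_two_end_coloring c ->
     exists F : {set edge G}, colored_Jstar_factor f c F).
Proof.
split=> [cnd c cP|]; last exact: colored_factor_odd_components.
have [|F _ degF] := almost_parity_factor_exists (incidence_odd_condition (c := c) cnd).
  by case=> [v|e] _ _ //=; rewrite addn_gt0 f_pos.
exists [set e | ((e, false) \in F) (+) green c (e, false)].
by apply: colored_factor_of_incidence => // z; apply: degF; rewrite inE.
Qed.
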